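(* Let $\mathcal C$ be a closed monoidal category admitting equalizers and coequalizers. (a) If $(A,\sigma)$ is a lax central commutative algebra in $\mathcal C$ such that the monoidal category ${}_A\mathcal C_A$ is rigid, then $\mathcal C_A^\sigma$ is rigid. (b) If $\mathcal C$ is braided and $A$ is a commutative algebra in $\mathcal C$ such that ${}_A\mathcal C_A$ is rigid, then both $\mathcal C_A$ and $\mathcal C_A^{\mathrm{loc}}$ are rigid. In all cases, the left duality functor of the category is given by $M\mapsto M^\dagger:=\underline{\mathrm{Hom}}_A(M,A)$.
   Context: A monoidal category $\mathcal C$ is closed if $X\otimes-$ and $-\otimes X$ have right adjoints for all $X$. $\underline{\mathrm{Hom}}(X,-)$ is the right adjoint of $-\otimes X$, with counit $\underline{\mathrm{ev}}_{X,Y}:\underline{\mathrm{Hom}}(X,Y)\otimes X\to Y$; the adjunct of $f:W\to\underline{\mathrm{Hom}}(X,Y)$ is $\underline{\mathrm{ev}}_{X,Y}(f\otimes\mathrm{id}_X)$. Rigid means every object has a left and a right dual. A lax half-braiding on $A$ is a natural transformation $\sigma_Y:A\otimes Y\to Y\otimes A$ (not necessarily invertible) with $\sigma_{\mathbf 1}=\mathrm{id}$ and $\sigma_{Y\otimes Z}=(\mathrm{id}_Y\otimes\sigma_Z)(\sigma_Y\otimes\mathrm{id}_Z)$. A lax central commutative algebra is an algebra $(A,\mu,\eta)$ with a lax half-braiding $\sigma$ such that $\sigma_X(\mu\otimes\mathrm{id}_X)=(\mathrm{id}_X\otimes\mu)(\sigma_X\otimes\mathrm{id}_A)(\mathrm{id}_A\otimes\sigma_X)$,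 $\sigma_X(\eta\otimes\mathrm{id}_X)=\mathrm{id}_X\otimes\eta$, and $\mu\sigma_A=\mu$. ${}_A\mathcal C_A$ is the category of $A$-bimodules, monoidal under the tensor product $\otimes_A$ over $A$ (a coequalizer), with unit $A$. $\mathcal C_A^\sigma$ is the full monoidal subcategory of bimodules $X$ whose left and right actions satisfy $a_X^\ell=a_X^r\circ\sigma_X$. If $\mathcal C$ is braided with braiding $c$ and $A$ is commutative ($\mu c_{A,A}=\mu$), $\mathcal C_A$ is the category of right $A$-modules, regarded as the monoidal category $\mathcal C_A^{\sigma}$ for $\sigma=c_{A,-}$ (left action $a_M^r c_{A,M}$), and $\mathcal C_A^{\mathrm{loc}}$ is its full monoidal subcategory of local modules, i.e. those with $a_M^r c_{A,M}c_{M,A}=a_M^r$. For $X,Y\in{}_A\mathcal C_A$, $\underline{\mathrm{Hom}}_A(X,Y)$ is the equalizer of the two morphisms $\underline{\mathrm{Hom}}(X,Y)\rightrightarrows\underline{\mathrm{Hom}}(X\otimes A,Y)$ with adjuncts $\underline{\mathrm{ev}}_{X,Y}(\mathrm{id}\otimes a_X^r)$ and $a_Y^r(\underline{\mathrm{ev}}_{X,Y}\otimes\mathrm{id}_A)$. It is a sub-bimodule of $\underline{\mathrm{Hom}}(X,Y)$, where the latter has left action with adjunct $a_Y^\ell(\mathrm{id}_A\otimes\underline{\mathrm{ev}}_{X,Y})$ and right action with adjunct $\underline{\mathrm{ev}}_{X,Y}(\mathrm{id}\otimes a_X^\ell)$. *)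

(* Defs.v *)
From Corelib Require Import ssreflect.
From Stdlib Require Import ProofIrrelevance.

Set Implicit Arguments.
Unset Strict Implicit.
Unset Printing Implicit Defensive.

Record category := Category {
  obj :> Type;
  hom : obj -> obj -> Type;
  idm : forall X, hom X X;
  comp : forall X Y Z, hom Y Z -> hom X Y -> hom X Z;
  compA : forall X Y Z W (h : hom Z W) (g : hom Y Z) (f : hom X Y),
    comp (comp h g) f = comp h (comp g f);
  id_l : forall X Y (f : hom X Y), comp (idm Y) f = f;
  id_r : forall X Y (f : hom X Y), comp f (idm X) = f
}.

Arguments hom {c} _ _.
Arguments idm {c} X.
Arguments comp {c X Y Z} _ _.

Notation "g ∘ f" := (comp g f) (at level 41, right associativity).

Record equalizers (C : category) := Equalizers {
  eqz : forall (X Y : C) (f g : hom X Y), C;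
  eqz_in : forall (X Y : C) (f g : hom X Y), hom (eqz f g) X;
  eqz_eq : forall (X Y : C) (f g : hom X Y), f ∘ eqz_in f g = g ∘ eqz_in f g;
  eqz_lift : forall (X Y W : C) (f g : hom X Y) (h : hom W X),
    f ∘ h = g ∘ h -> hom W (eqz f g);
  eqz_liftE : forall (X Y W : C) (f g : hom X Y) (h : hom W X)
    (e : f ∘ h = g ∘ h), eqz_in f g ∘ eqz_lift e = h;
  eqz_uniq : forall (X Y W : C) (f g : hom X Y) (k k' : hom W (eqz f g)),
    eqz_in f g ∘ k = eqz_in f g ∘ k' -> k = k'
}.

Record coequalizers (C : category) := Coequalizers {
  coeq : forall (X Y : C) (f g : hom X Y), C;
  coeq_pr : forall (X Y : C) (f g : hom X Y), hom Y (coeq f g);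
  coeq_eq : forall (X Y : C) (f g : hom X Y),
    coeq_pr f g ∘ f = coeq_pr f g ∘ g;
  coeq_desc : forall (X Y W : C) (f g : hom X Y) (h : hom Y W),
    h ∘ f = h ∘ g -> hom (coeq f g) W;
  coeq_descE : forall (X Y W : C) (f g : hom X Y) (h : hom Y W)
    (e : h ∘ f = h ∘ g), coeq_desc e ∘ coeq_pr f g = h;
  coeq_uniq : forall (X Y W : C) (f g : hom X Y) (k k' : hom (coeq f g) W),
    k ∘ coeq_pr f g = k' ∘ coeq_pr f g -> k = k'
}.

Record monoidal := Monoidal {
  mcat :> category;
  munit : mcat;
  tens : mcat -> mcat -> mcat;
  tensh : forall X X' Y Y' : mcat,
    hom X X' -> hom Y Y' -> hom (tens X Y) (tens X' Y');
  asc : forall X Y Z : mcat, hom (tens (tens X Y) Z) (tens X (tens Y Z));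
  asci : forall X Y Z : mcat, hom (tens X (tens Y Z)) (tens (tens X Y) Z);
  lun : forall X : mcat, hom (tens munit X) X;
  luni : forall X : mcat, hom X (tens munit X);
  run : forall X : mcat, hom (tens X munit) X;
  runi : forall X : mcat, hom X (tens X munit);
  tensh_id : forall X Y : mcat, tensh (idm X) (idm Y) = idm (tens X Y);
  tensh_comp : forall (X X' X'' Y Y' Y'' : mcat)
    (f' : hom X' X'') (f : hom X X') (g' : hom Y' Y'') (g : hom Y Y'),
    tensh (f' ∘ f) (g' ∘ g) = tensh f' g' ∘ tensh f g;
  ascK : forall X Y Z : mcat, asci X Y Z ∘ asc X Y Z = idm _;
  asciK : forall X Y Z : mcat, asc X Y Z ∘ asci X Y Z = idm _;
  lunK : forall X : mcat, luni X ∘ lun X = idm _;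
  luniK : forall X : mcat, lun X ∘ luni X = idm _;
  runK : forall X : mcat, runi X ∘ run X = idm _;
  runiK : forall X : mcat, run X ∘ runi X = idm _;
  asc_nat : forall (X X' Y Y' Z Z' : mcat)
    (f : hom X X') (g : hom Y Y') (h : hom Z Z'),
    asc X' Y' Z' ∘ tensh (tensh f g) h = tensh f (tensh g h) ∘ asc X Y Z;
  lun_nat : forall (X Y : mcat) (f : hom X Y),
    lun Y ∘ tensh (idm munit) f = f ∘ lun X;
  run_nat : forall (X Y : mcat) (f : hom X Y),
    run Y ∘ tensh f (idm munit) = f ∘ run X;
  pentagon : forall X Y Z W : mcat,
    tensh (idm X) (asc Y Z W) ∘ asc X (tens Y Z) W ∘ tensh (asc X Y Z) (idm W)
    = asc X Y (tens Z W) ∘ asc (tens X Y) Z W;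
  triangle : forall X Y : mcat,
    tensh (idm X) (lun Y) ∘ asc X munit Y = tensh (run X) (idm Y)
}.

Arguments munit {m}.
Arguments tens {m} _ _.
Arguments tensh {m X X' Y Y'} _ _.
Arguments asc {m} X Y Z.
Arguments asci {m} X Y Z.
Arguments lun {m} X.
Arguments luni {m} X.
Arguments run {m} X.
Arguments runi {m} X.

Notation "𝟙" := munit.
Notation "X ⊗ Y" := (tens X Y) (at level 34, left associativity).
Notation "f ⊠ g" := (tensh f g) (at level 36, no associativity).
Notation "f ▷ Z" := (tensh f (idm Z)) (at level 36, no associativity).
Notation "Z ◁ f" := (tensh (idm Z) f) (at level 36, no associativity).

(* [ihom X] is right adjoint to [- ⊗ X] and [lhom X] to [X ⊗ -], both given by
   a universal arrow (the counit). *)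
Record closed (C : monoidal) := Closed {
  ihom : C -> C -> C;
  iev : forall X Y : C, hom (ihom X Y ⊗ X) Y;
  icur : forall X Y W : C, hom (W ⊗ X) Y -> hom W (ihom X Y);
  icurE : forall (X Y W : C) (f : hom (W ⊗ X) Y), iev X Y ∘ (icur f ▷ X) = f;
  icur_uniq : forall (X Y W : C) (k k' : hom W (ihom X Y)),
    iev X Y ∘ (k ▷ X) = iev X Y ∘ (k' ▷ X) -> k = k';
  lhom : C -> C -> C;
  lev : forall X Y : C, hom (X ⊗ lhom X Y) Y;
  lcur : forall X Y W : C, hom (X ⊗ W) Y -> hom W (lhom X Y);
  lcurE : forall (X Y W : C) (f : hom (X ⊗ W) Y), lev X Y ∘ (X ◁ lcur f) = f;
  lcur_uniq : forall (X Y W : C) (k k' : hom W (lhom X Y)),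
    lev X Y ∘ (X ◁ k) = lev X Y ∘ (X ◁ k') -> k = k'
}.

Arguments ihom {C} c X Y.
Arguments iev {C} c X Y.
Arguments icur {C} c {X Y W} f.
Arguments lhom {C} c X Y.
Arguments lev {C} c X Y.
Arguments lcur {C} c {X Y W} f.

Record braiding (C : monoidal) := Braiding {
  br : forall X Y : C, hom (X ⊗ Y) (Y ⊗ X);
  bri : forall X Y : C, hom (Y ⊗ X) (X ⊗ Y);
  brK : forall X Y : C, bri X Y ∘ br X Y = idm _;
  briK : forall X Y : C, br X Y ∘ bri X Y = idm _;
  br_nat : forall (X X' Y Y' : C) (f : hom X X') (g : hom Y Y'),
    br X' Y' ∘ (f ⊠ g) = (g ⊠ f) ∘ br X Y;
  hexagon1 : forall X Y Z : C,
    asc Y Z X ∘ br X (Y ⊗ Z) ∘ asc X Y Z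
    = (Y ◁ br X Z) ∘ asc Y X Z ∘ (br X Y ▷ Z);
  hexagon2 : forall X Y Z : C,
    asci Z X Y ∘ br (X ⊗ Y) Z ∘ asci X Y Z
    = (br X Z ▷ Y) ∘ asci X Z Y ∘ (X ◁ br Y Z)
}.

Arguments br {C} b X Y.
Arguments bri {C} b X Y.

(* Left dual convention: [Y] is a left dual of [X] (and [X] a right dual of [Y]). *)
Definition is_dual (V : monoidal) (X Y : V)
    (ev : hom (Y ⊗ X) 𝟙) (coev : hom 𝟙 (X ⊗ Y)) : Prop :=
  run X ∘ (X ◁ ev) ∘ asc X Y X ∘ (coev ▷ X) ∘ luni X = idm X /\
  lun Y ∘ (ev ▷ Y) ∘ asci Y X Y ∘ (Y ◁ coev) ∘ runi Y = idm Y.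

Definition has_left_dual (V : monoidal) (X : V) : Prop :=
  exists (Y : V) (ev : hom (Y ⊗ X) 𝟙) (coev : hom 𝟙 (X ⊗ Y)), is_dual ev coev.

Definition has_right_dual (V : monoidal) (X : V) : Prop :=
  exists (Y : V) (ev : hom (X ⊗ Y) 𝟙) (coev : hom 𝟙 (Y ⊗ X)), is_dual ev coev.

Definition rigid (V : monoidal) : Prop :=
  forall X : V, has_left_dual X /\ has_right_dual X.

(* The dual morphism of [f] for left duals [M'] of [M] and [N'] of [N]. *)
Definition dual_mor (V : monoidal) (M M' N N' : V)
    (coevM : hom 𝟙 (M ⊗ M')) (evN : hom (N' ⊗ N) 𝟙) (f : hom M N) :
    hom N' M' :=
  lun M' ∘ (evN ▷ M') ∘ asci N' N M' ∘ (N' ◁ (f ▷ M')) ∘ (N' ◁ coevM) ∘ runi N'.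

Definition is_left_duality_functor (V : monoidal) (D : V -> V)
    (Dmor : forall M N : V, hom M N -> hom (D N) (D M)) : Prop :=
  exists (ev : forall M : V, hom (D M ⊗ M) 𝟙)
         (coev : forall M : V, hom 𝟙 (M ⊗ D M)),
    (forall M, is_dual (ev M) (coev M)) /\
    (forall M N (f : hom M N), Dmor M N f = dual_mor (coev M) (ev N) f).

Section CategoryLemmas.
Context (C : category).

Definition epi (X Y : C) (e : hom X Y) : Prop :=
  forall (W : C) (h h' : hom Y W), h ∘ e = h' ∘ e -> h = h'.

Lemma epi_comp (X Y Z : C) (e : hom X Y) (e' : hom Y Z) :
  epi e -> epi e' -> epi (e' ∘ e).
Proof. by move=> he he' W h h'; rewrite -!compA => /he /he'. Qed.

Lemma coeq_epi (cq : coequalizers C) (X Y : C) (f g : hom X Y) :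
  epi (coeq_pr cq f g).
Proof. by move=> W h h'; exact: coeq_uniq. Qed.

Lemma iso_epi (X Y : C) (f : hom X Y) (g : hom Y X) : f ∘ g = idm Y -> epi f.
Proof.
move=> e W h h' E; have := f_equal (fun k => k ∘ g) E.
by rewrite /= !compA e !id_r.
Qed.

(* Rewriting with an equation inside right-nested composites. *)
Lemma rw2 (X Y Z W : C) (f : hom Y Z) (g : hom X Y) (h : hom X Z)
  (k : hom W X) : f ∘ g = h -> f ∘ g ∘ k = h ∘ k.
Proof. by move=> <-; rewrite compA. Qed.

Lemma rw3 (X Y Z W V : C) (f : hom Y Z) (g : hom X Y) (h : hom V X)
  (r : hom V Z) (k : hom W V) : f ∘ g ∘ h = r -> f ∘ g ∘ h ∘ k = r ∘ k.
Proof. by move=> <-; rewrite !compA. Qed.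

End CategoryLemmas.

Section MonoidalLemmas.
Context (C : monoidal).
Implicit Types X Y Z W : C.

Lemma whL X Y Z W (g : hom Y Z) (f : hom X Y) :
  W ◁ (g ∘ f) = (W ◁ g) ∘ (W ◁ f).
Proof. by rewrite -tensh_comp id_l. Qed.

Lemma whR X Y Z W (g : hom Y Z) (f : hom X Y) :
  (g ∘ f) ▷ W = (g ▷ W) ∘ (f ▷ W).
Proof. by rewrite -tensh_comp id_l. Qed.

Lemma fuL X Y Z W V (g : hom Y Z) (f : hom X Y) (k : hom V (W ⊗ X)) :
  (W ◁ g) ∘ (W ◁ f) ∘ k = (W ◁ (g ∘ f)) ∘ k.
Proof. by rewrite whL compA. Qed.

Lemma fuR X Y Z W V (g : hom Y Z) (f : hom X Y) (k : hom V (X ⊗ W)) :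
  (g ▷ W) ∘ (f ▷ W) ∘ k = ((g ∘ f) ▷ W) ∘ k.
Proof. by rewrite whR compA. Qed.

Lemma tenshLR X X' Y Y' (f : hom X X') (g : hom Y Y') :
  f ⊠ g = (X' ◁ g) ∘ (f ▷ Y).
Proof. by rewrite -tensh_comp id_l id_r. Qed.

Lemma tenshRL X X' Y Y' (f : hom X X') (g : hom Y Y') :
  f ⊠ g = (f ▷ Y') ∘ (X ◁ g).
Proof. by rewrite -tensh_comp id_l id_r. Qed.

Lemma xch X X' Y Y' (f : hom X X') (g : hom Y Y') :
  (X' ◁ g) ∘ (f ▷ Y) = (f ▷ Y') ∘ (X ◁ g).
Proof. by rewrite -tenshLR tenshRL. Qed.

Lemma asci_nat X X' Y Y' Z Z' (f : hom X X') (g : hom Y Y') (h : hom Z Z') :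
  asci X' Y' Z' ∘ (f ⊠ (g ⊠ h)) = ((f ⊠ g) ⊠ h) ∘ asci X Y Z.
Proof.
apply: (iso_epi (asciK _ _ _)).
by rewrite !compA -asc_nat (rw2 _ (ascK _ _ _)) ascK id_l id_r.
Qed.

Lemma ascR X X' Y Z (f : hom X X') :
  asc X' Y Z ∘ ((f ▷ Y) ▷ Z) = (f ▷ (Y ⊗ Z)) ∘ asc X Y Z.
Proof. by rewrite asc_nat tensh_id. Qed.
Lemma ascM X Y Y' Z (f : hom Y Y') :
  asc X Y' Z ∘ ((X ◁ f) ▷ Z) = (X ◁ (f ▷ Z)) ∘ asc X Y Z.
Proof. by rewrite asc_nat. Qed.
Lemma ascL X Y Z Z' (f : hom Z Z') :
  asc X Y Z' ∘ ((X ⊗ Y) ◁ f) = (X ◁ (Y ◁ f)) ∘ asc X Y Z.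
Proof. by rewrite -asc_nat tensh_id. Qed.
Lemma asciR X X' Y Z (f : hom X X') :
  asci X' Y Z ∘ (f ▷ (Y ⊗ Z)) = ((f ▷ Y) ▷ Z) ∘ asci X Y Z.
Proof. by rewrite -asci_nat tensh_id. Qed.
Lemma asciM X Y Y' Z (f : hom Y Y') :
  asci X Y' Z ∘ (X ◁ (f ▷ Z)) = ((X ◁ f) ▷ Z) ∘ asci X Y Z.
Proof. by rewrite asci_nat. Qed.
Lemma asciL X Y Z Z' (f : hom Z Z') :
  asci X Y Z' ∘ (X ◁ (Y ◁ f)) = ((X ⊗ Y) ◁ f) ∘ asci X Y Z.
Proof. by rewrite asci_nat tensh_id. Qed.

Lemma luni_nat X Y (f : hom X Y) : luni Y ∘ f = (𝟙 ◁ f) ∘ luni X.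
Proof.
rewrite -[f in LHS]id_r -(luniK X).
by rewrite -(compA f) -lun_nat !compA (rw2 _ (lunK Y)) id_l.
Qed.

Lemma runi_nat X Y (f : hom X Y) : runi Y ∘ f = (f ▷ 𝟙) ∘ runi X.
Proof.
rewrite -[f in LHS]id_r -(runiK X).
by rewrite -(compA f) -run_nat !compA (rw2 _ (runK Y)) id_l.
Qed.

Lemma whL_inj X Y (f g : hom X Y) : 𝟙 ◁ f = 𝟙 ◁ g -> f = g.
Proof.
move=> E; apply: (iso_epi (luniK X)); by rewrite -!lun_nat E.
Qed.

Lemma whR_inj X Y (f g : hom X Y) : f ▷ 𝟙 = g ▷ 𝟙 -> f = g.
Proof.
move=> E; apply: (iso_epi (runiK X)); by rewrite -!run_nat E.
Qed.

Lemma whR_iso X Y Z (f : hom X Y) (g : hom Y X) :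
  f ∘ g = idm Y -> (f ▷ Z) ∘ (g ▷ Z) = idm _.
Proof. by move=> e; rewrite -whR e tensh_id. Qed.

Lemma whL_iso X Y Z (f : hom X Y) (g : hom Y X) :
  f ∘ g = idm Y -> (Z ◁ f) ∘ (Z ◁ g) = idm _.
Proof. by move=> e; rewrite -whL e tensh_id. Qed.

Lemma lun_asc X Y : lun (X ⊗ Y) ∘ asc 𝟙 X Y = lun X ▷ Y.
Proof.
apply: whL_inj; apply: (iso_epi (asciK _ _ _)).
apply: (iso_epi (whR_iso Y (asciK 𝟙 𝟙 X))).
rewrite whL !compA pentagon (rw2 _ (triangle _ _)) -ascR -triangle whR.
by rewrite (rw2 _ (ascM _ _ _)) !compA.
Qed.

Lemma run_asc X Y : (X ◁ run Y) ∘ asc X Y 𝟙 = run (X ⊗ Y).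
Proof.
apply: whR_inj.
rewrite -[LHS]id_l -[RHS]id_l -ascK !compA; congr (_ ∘ _).
rewrite whR (rw2 _ (ascM _ _ _)) -triangle whL !compA pentagon.
by rewrite (rw2 _ (eq_sym (ascL _ _ _))) !compA triangle.
Qed.

Lemma lun_asci X Y : (lun X ▷ Y) ∘ asci 𝟙 X Y = lun (X ⊗ Y).
Proof. by rewrite -lun_asc compA asciK id_r. Qed.

Lemma run_asci X Y : run (X ⊗ Y) ∘ asci X Y 𝟙 = X ◁ run Y.
Proof. by rewrite -run_asc compA asciK id_r. Qed.

Lemma triangle_i X Y : (run X ▷ Y) ∘ asci X 𝟙 Y = X ◁ lun Y.
Proof. by rewrite -triangle compA asciK id_r. Qed.

Lemma pentagon_i X Y Z W :
  (asci X Y Z ▷ W) ∘ asci X (Y ⊗ Z) W ∘ (X ◁ asci Y Z W)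
  = asci (X ⊗ Y) Z W ∘ asci X Y (Z ⊗ W).
Proof.
apply: (iso_epi (asciK X Y (Z ⊗ W))).
apply: (iso_epi (asciK (X ⊗ Y) Z W)).
rewrite !compA (rw2 _ (ascK _ _ _)) id_l ascK -pentagon.
rewrite (rw2 _ (whL_iso _ (ascK _ _ _))) id_l (rw2 _ (ascK _ _ _)) id_l.
by rewrite (whR_iso _ (ascK _ _ _)).
Qed.

Context (cl : closed C).

Lemma epiR X Y Z (e : hom X Y) : epi e -> epi (e ▷ Z).
Proof.
move=> he W h h' E.
rewrite -(icurE cl h) -(icurE cl h'); congr (_ ∘ (_ ▷ _)).
by apply: he; apply: (icur_uniq (c := cl)); rewrite !whR -!compA !icurE.
Qed.

Lemma epiL X Y Z (e : hom X Y) : epi e -> epi (Z ◁ e).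
Proof.
move=> he W h h' E.
rewrite -(lcurE cl h) -(lcurE cl h'); congr (_ ∘ (_ ◁ _)).
by apply: he; apply: (lcur_uniq (c := cl)); rewrite !whL -!compA !lcurE.
Qed.

Context (cq : coequalizers C).

(* Tensoring preserves coequalizers because it has a right adjoint. *)
Lemma descR_sig X Y Z W (f g : hom X Y) (h : hom (Y ⊗ Z) W) :
  h ∘ (f ▷ Z) = h ∘ (g ▷ Z) ->
  {k : hom (coeq cq f g ⊗ Z) W | k ∘ (coeq_pr cq f g ▷ Z) = h}.
Proof.
move=> E; have e : icur cl h ∘ f = icur cl h ∘ g.
  by apply: (icur_uniq (c := cl)); rewrite !whR -!compA !icurE.
exists (iev cl Z W ∘ (coeq_desc cq e ▷ Z)).
by rewrite compA -whR coeq_descE icurE.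
Qed.

Lemma descL_sig X Y Z W (f g : hom X Y) (h : hom (Z ⊗ Y) W) :
  h ∘ (Z ◁ f) = h ∘ (Z ◁ g) ->
  {k : hom (Z ⊗ coeq cq f g) W | k ∘ (Z ◁ coeq_pr cq f g) = h}.
Proof.
move=> E; have e : lcur cl h ∘ f = lcur cl h ∘ g.
  by apply: (lcur_uniq (c := cl)); rewrite !whL -!compA !lcurE.
exists (lev cl Z W ∘ (Z ◁ coeq_desc cq e)).
by rewrite compA -whL coeq_descE lcurE.
Qed.

Definition descR X Y Z W (f g : hom X Y) (h : hom (Y ⊗ Z) W)
    (e : h ∘ (f ▷ Z) = h ∘ (g ▷ Z)) : hom (coeq cq f g ⊗ Z) W :=
  proj1_sig (descR_sig e).

Definition descL X Y Z W (f g : hom X Y) (h : hom (Z ⊗ Y) W)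
    (e : h ∘ (Z ◁ f) = h ∘ (Z ◁ g)) : hom (Z ⊗ coeq cq f g) W :=
  proj1_sig (descL_sig e).

Lemma descRE X Y Z W (f g : hom X Y) (h : hom (Y ⊗ Z) W)
    (e : h ∘ (f ▷ Z) = h ∘ (g ▷ Z)) :
  descR e ∘ (coeq_pr cq f g ▷ Z) = h.
Proof. exact: proj2_sig (descR_sig e). Qed.

Lemma descLE X Y Z W (f g : hom X Y) (h : hom (Z ⊗ Y) W)
    (e : h ∘ (Z ◁ f) = h ∘ (Z ◁ g)) :
  descL e ∘ (Z ◁ coeq_pr cq f g) = h.
Proof. exact: proj2_sig (descL_sig e). Qed.

End MonoidalLemmas.

Section PentagonForms.
Context (C : monoidal).
Implicit Types X Y Z W : C.

Lemma penta1 X Y Z W :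
  (X ◁ asci Y Z W) ∘ asc X Y (Z ⊗ W) ∘ asc (X ⊗ Y) Z W
  = asc X (Y ⊗ Z) W ∘ (asc X Y Z ▷ W).
Proof. by rewrite -pentagon (rw2 _ (whL_iso _ (ascK _ _ _))) ?compA id_l. Qed.

Lemma penta2 X Y Z W :
  asc (X ⊗ Y) Z W ∘ (asci X Y Z ▷ W)
  = asci X Y (Z ⊗ W) ∘ (X ◁ asc Y Z W) ∘ asc X (Y ⊗ Z) W.
Proof.
apply: (iso_epi (whR_iso W (asciK X Y Z))).
by rewrite ?compA pentagon (rw2 _ (ascK _ _ _)) ?compA (whR_iso _ (ascK _ _ _)) id_l id_r.
Qed.

Lemma penta3 X Y Z W :
  asc (X ⊗ Y) Z W ∘ (asci X Y Z ▷ W) ∘ asci X (Y ⊗ Z) W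
  = asci X Y (Z ⊗ W) ∘ (X ◁ asc Y Z W).
Proof. by rewrite (rw2 _ (penta2 _ _ _ _)) ?compA asciK id_r. Qed.

Lemma penta4 X Y Z W :
  asci X (Y ⊗ Z) W ∘ (X ◁ asci Y Z W) ∘ asc X Y (Z ⊗ W)
  = (asc X Y Z ▷ W) ∘ asci (X ⊗ Y) Z W.
Proof.
apply: (iso_epi (asciK (X ⊗ Y) Z W)).
by rewrite ?compA penta1 (rw2 _ (ascK _ _ _)) ?compA ascK id_l id_r.
Qed.

End PentagonForms.

Record algebra (C : monoidal) := Algebra {
  acar :> C;
  mul : hom (acar ⊗ acar) acar;
  one : hom 𝟙 acar;
  mulA : mul ∘ (mul ▷ acar) = mul ∘ (acar ◁ mul) ∘ asc acar acar acar;
  mul1l : mul ∘ (one ▷ acar) = lun acar;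
  mul1r : mul ∘ (acar ◁ one) = run acar
}.

Arguments mul {C} a.
Arguments one {C} a.

Record bimodule (C : monoidal) (A : algebra C) := Bimodule {
  bcar :> C;
  la : hom (A ⊗ bcar) bcar;
  ra : hom (bcar ⊗ A) bcar;
  laA : la ∘ (mul A ▷ bcar) = la ∘ (A ◁ la) ∘ asc A A bcar;
  la1 : la ∘ (one A ▷ bcar) = lun bcar;
  raA : ra ∘ (ra ▷ A) = ra ∘ (bcar ◁ mul A) ∘ asc bcar A A;
  ra1 : ra ∘ (bcar ◁ one A) = run bcar;
  lraA : ra ∘ (la ▷ A) = la ∘ (A ◁ ra) ∘ asc A bcar A
}.

Arguments la {C A} b.
Arguments ra {C A} b.

Record bimodule_hom (C : monoidal) (A : algebra C) (X Y : bimodule A) :=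
    BimoduleHom {
  bmor :> hom (bcar X) (bcar Y);
  bmor_l : bmor ∘ la X = la Y ∘ (A ◁ bmor);
  bmor_r : bmor ∘ ra X = ra Y ∘ (bmor ▷ A)
}.

Section Bimodules.
Context (C : monoidal) (A : algebra C).
Implicit Types X Y Z W : bimodule A.

Lemma bmor_inj X Y (f g : bimodule_hom X Y) : bmor f = bmor g -> f = g.
Proof.
case: f g => [f fl fr] [g gl gr] /= e; case: g / e gl gr => gl gr.
by rewrite (proof_irrelevance _ fl gl) (proof_irrelevance _ fr gr).
Qed.

Program Definition bim_id X : bimodule_hom X X := @BimoduleHom _ _ X X (idm _) _ _.
Next Obligation. by move=> X; rewrite tensh_id id_l id_r. Qed.
Next Obligation. by move=> X; rewrite tensh_id id_l id_r. Qed.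

Program Definition bim_comp X Y Z (g : bimodule_hom Y Z) (f : bimodule_hom X Y) :
  bimodule_hom X Z := @BimoduleHom _ _ X Z (bmor g ∘ bmor f) _ _.
Next Obligation.
by move=> X Y Z g f; rewrite compA bmor_l (rw2 _ (bmor_l g)) ?compA whL ?compA.
Qed.
Next Obligation.
by move=> X Y Z g f; rewrite compA bmor_r (rw2 _ (bmor_r g)) ?compA whR ?compA.
Qed.

Program Definition bimod_cat : category :=
  @Category (bimodule A) (@bimodule_hom C A) bim_id bim_comp _ _ _.
Next Obligation. by move=> X Y Z W h g f; apply: bmor_inj; rewrite /= compA. Qed.
Next Obligation. by move=> X Y f; apply: bmor_inj; rewrite /= id_l. Qed.
Next Obligation. by move=> X Y f; apply: bmor_inj; rewrite /= id_r. Qed.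

Definition regular : bimodule A :=
  @Bimodule C A A (mul A) (mul A) (mulA A) (mul1l A) (mulA A) (mul1r A) (mulA A).

Context (cl : closed C) (cq : coequalizers C).

Definition btens_car X Y : C := coeq cq (ra X ▷ Y) ((X ◁ la Y) ∘ asc X A Y).

Definition bpr X Y : hom (X ⊗ Y) (btens_car X Y) :=
  coeq_pr cq (ra X ▷ Y) ((X ◁ la Y) ∘ asc X A Y).

Lemma bpr_bal X Y : bpr X Y ∘ (ra X ▷ Y) = bpr X Y ∘ (X ◁ la Y) ∘ asc X A Y.
Proof. exact: coeq_eq. Qed.

Lemma bpr_epi X Y : epi (bpr X Y).
Proof. exact: coeq_epi. Qed.

Lemma bpr_epiR X Y (Z : C) : epi (bpr X Y ▷ Z).
Proof. exact: (epiR cl (@bpr_epi X Y)). Qed.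

Lemma bpr_epiL X Y (Z : C) : epi (Z ◁ bpr X Y).
Proof. exact: (epiL cl (@bpr_epi X Y)). Qed.

Lemma btens_la_proof X Y :
  (bpr X Y ∘ (la X ▷ Y) ∘ asci A X Y) ∘ (A ◁ (ra X ▷ Y)) =
  (bpr X Y ∘ (la X ▷ Y) ∘ asci A X Y) ∘ (A ◁ ((X ◁ la Y) ∘ asc X A Y)).
Proof.
rewrite whL ?compA asciM (rw2 _ (asciL _ _ _)) ?compA.
have e : la X ∘ (A ◁ ra X) = ra X ∘ (la X ▷ A) ∘ asci A X A.
  by rewrite (rw2 _ (lraA X)) ?compA asciK id_r.
rewrite fuR e !whR ?compA (rw2 _ (bpr_bal _ _)) ?compA.
by rewrite (rw2 _ (ascR _ _ _)) ?compA penta3 (rw2 _ (xch _ _)) ?compA.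
Qed.

Definition btens_la X Y : hom (A ⊗ btens_car X Y) (btens_car X Y) :=
  descL cl cq (btens_la_proof X Y).

Lemma btens_ra_proof X Y :
  (bpr X Y ∘ (X ◁ ra Y) ∘ asc X Y A) ∘ ((ra X ▷ Y) ▷ A) =
  (bpr X Y ∘ (X ◁ ra Y) ∘ asc X Y A) ∘ (((X ◁ la Y) ∘ asc X A Y) ▷ A).
Proof.
rewrite whR ?compA ascR (rw2 _ (xch _ _)) ?compA (rw2 _ (bpr_bal _ _)) ?compA.
rewrite (rw2 _ (ascL _ _ _)) ?compA (rw2 _ (ascM _ _ _)) ?compA -penta1.
rewrite !fuL ?compA.
by rewrite (rw2 _ (lraA Y)) ?compA asciK id_r.
Qed.

Definition btens_ra X Y : hom (btens_car X Y ⊗ A) (btens_car X Y) :=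
  descR cl cq (btens_ra_proof X Y).

Lemma btens_laE X Y :
  btens_la X Y ∘ (A ◁ bpr X Y) = bpr X Y ∘ (la X ▷ Y) ∘ asci A X Y.
Proof. exact: descLE. Qed.

Lemma btens_raE X Y :
  btens_ra X Y ∘ (bpr X Y ▷ A) = bpr X Y ∘ (X ◁ ra Y) ∘ asc X Y A.
Proof. exact: descRE. Qed.

Lemma btens_laA X Y :
  btens_la X Y ∘ (mul A ▷ btens_car X Y)
  = btens_la X Y ∘ (A ◁ btens_la X Y) ∘ asc A A (btens_car X Y).
Proof.
apply: (bpr_epiL (Z := A ⊗ A)).
rewrite ?compA. rewrite -xch. rewrite (rw2 _ (btens_laE X Y)) ?compA ascL fuL btens_laE !whL ?compA.
rewrite (rw2 _ (btens_laE X Y)) ?compA asciR (rw2 _ (asciM _ _ _)) ?compA penta4.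
by rewrite !fuR laA !whR ?compA.
Qed.

Lemma btens_la1 X Y :
  btens_la X Y ∘ (one A ▷ btens_car X Y) = lun (btens_car X Y).
Proof.
apply: (bpr_epiL (Z := 𝟙)).
by rewrite ?compA -xch (rw2 _ (btens_laE X Y)) ?compA asciR fuR la1 lun_asci lun_nat.
Qed.

Lemma btens_raA X Y :
  btens_ra X Y ∘ (btens_ra X Y ▷ A)
  = btens_ra X Y ∘ (btens_car X Y ◁ mul A) ∘ asc (btens_car X Y) A A.
Proof.
apply: (epiR cl (bpr_epiR (Z := A))).
rewrite ?compA -whR btens_raE ascR !whR (rw2 _ (btens_raE X Y)) ?compA.
rewrite (rw2 _ (xch _ _)) ?compA (rw2 _ (btens_raE X Y)) ?compA.
rewrite (rw2 _ (ascM _ _ _)) ?compA (rw2 _ (ascL _ _ _)) ?compA -pentagon.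
by rewrite !fuL ?compA raA.
Qed.

Lemma btens_ra1 X Y :
  btens_ra X Y ∘ (btens_car X Y ◁ one A) = run (btens_car X Y).
Proof.
apply: (bpr_epiR (Z := 𝟙)).
rewrite ?compA xch (rw2 _ (btens_raE X Y)) ?compA ascL fuL ra1.
by rewrite run_asc run_nat.
Qed.

Lemma btens_lraA X Y :
  btens_ra X Y ∘ (btens_la X Y ▷ A)
  = btens_la X Y ∘ (A ◁ btens_ra X Y) ∘ asc A (btens_car X Y) A.
Proof.
apply: (epiR cl (bpr_epiL (Z := A))).
rewrite ?compA -whR btens_laE ascM fuL btens_raE !whR !whL ?compA.
rewrite (rw2 _ (btens_raE X Y)) ?compA (rw2 _ (btens_laE X Y)) ?compA.
rewrite (rw2 _ (ascR _ _ _)) ?compA (rw2 _ (asciL _ _ _)) ?compA.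
by rewrite (rw2 _ (xch _ _)) ?compA penta2.
Qed.

Definition btens X Y : bimodule A :=
  Bimodule (btens_laA X Y) (btens_la1 X Y) (btens_raA X Y) (btens_ra1 X Y)
    (btens_lraA X Y).

Lemma btens_hom_proof X X' Y Y' (f : bimodule_hom X X') (g : bimodule_hom Y Y') :
  (bpr X' Y' ∘ (f ⊠ g)) ∘ (ra X ▷ Y)
  = (bpr X' Y' ∘ (f ⊠ g)) ∘ (X ◁ la Y) ∘ asc X A Y.
Proof.
rewrite ?compA -tensh_comp (rw2 _ (eq_sym (tensh_comp _ _ _ _))) ?compA !id_r.
rewrite bmor_r bmor_l -[bmor g in LHS]id_l -[bmor f in RHS]id_l !tensh_comp.
by rewrite (rw2 _ (bpr_bal _ _)) ?compA asc_nat.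
Qed.

Definition btens_mor X X' Y Y' (f : bimodule_hom X X') (g : bimodule_hom Y Y') :
    hom (btens_car X Y) (btens_car X' Y') :=
  coeq_desc cq (btens_hom_proof f g).

Lemma btens_morE X X' Y Y' (f : bimodule_hom X X') (g : bimodule_hom Y Y') :
  btens_mor f g ∘ bpr X Y = bpr X' Y' ∘ (f ⊠ g).
Proof. exact: coeq_descE. Qed.

Lemma btens_mor_l X X' Y Y' (f : bimodule_hom X X') (g : bimodule_hom Y Y') :
  btens_mor f g ∘ la (btens X Y) = la (btens X' Y') ∘ (A ◁ btens_mor f g).
Proof.
apply: (bpr_epiL (Z := A)); rewrite /= ?compA -whL btens_laE btens_morE whL.
rewrite (rw2 _ (btens_laE _ _)) ?compA (rw2 _ (btens_morE _ _)) ?compA asci_nat.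
by do 2!rewrite (rw2 _ (eq_sym (tensh_comp _ _ _ _))) ?compA; rewrite id_l id_r bmor_l.
Qed.

Lemma btens_mor_r X X' Y Y' (f : bimodule_hom X X') (g : bimodule_hom Y Y') :
  btens_mor f g ∘ ra (btens X Y) = ra (btens X' Y') ∘ (btens_mor f g ▷ A).
Proof.
apply: (bpr_epiR (Z := A)); rewrite /= ?compA -whR btens_raE btens_morE whR.
rewrite (rw2 _ (btens_raE _ _)) ?compA (rw2 _ (btens_morE _ _)) ?compA asc_nat.
by do 2!rewrite (rw2 _ (eq_sym (tensh_comp _ _ _ _))) ?compA; rewrite id_l id_r bmor_r.
Qed.

Definition btens_hom X X' Y Y' (f : bimodule_hom X X') (g : bimodule_hom Y Y') :
    bimodule_hom (btens X Y) (btens X' Y') :=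
  @BimoduleHom C A (btens X Y) (btens X' Y') (btens_mor f g)
    (btens_mor_l f g) (btens_mor_r f g).

(* The associator and unitors are the unique morphisms compatible with those of
   [C] along the projections [bpr]. *)
Lemma basc1_proof X Y Z :
  (bpr X (btens Y Z) ∘ (X ◁ bpr Y Z) ∘ asc X Y Z) ∘ ((ra X ▷ Y) ▷ Z) =
  (bpr X (btens Y Z) ∘ (X ◁ bpr Y Z) ∘ asc X Y Z) ∘
    (((X ◁ la Y) ∘ asc X A Y) ▷ Z).
Proof.
rewrite !whR ?compA ascR (rw2 _ (xch _ _)) ?compA (rw2 _ (bpr_bal _ _)) ?compA /=.
rewrite (rw2 _ (ascL _ _ _)) ?compA fuL btens_laE.
by rewrite !whL ?compA penta1 (rw2 _ (ascM _ _ _)) ?compA.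
Qed.

Definition basc1 X Y Z : hom (btens X Y ⊗ Z) (btens X (btens Y Z)) :=
  descR cl cq (basc1_proof X Y Z).

Lemma basc1E X Y Z :
  basc1 X Y Z ∘ (bpr X Y ▷ Z) = bpr X (btens Y Z) ∘ (X ◁ bpr Y Z) ∘ asc X Y Z.
Proof. exact: descRE. Qed.

Lemma basc2_proof X Y Z :
  basc1 X Y Z ∘ (ra (btens X Y) ▷ Z)
  = basc1 X Y Z ∘ (btens X Y ◁ la Z) ∘ asc (btens X Y) A Z.
Proof.
apply: (epiR cl (bpr_epiR (Z := A))); rewrite /= ?compA -whR btens_raE ascR.
rewrite !whR (rw2 _ (basc1E _ _ _)) ?compA (rw2 _ (xch _ _)) ?compA.
rewrite (rw2 _ (basc1E _ _ _)) ?compA (rw2 _ (ascM _ _ _)) ?compA (rw2 _ (ascL _ _ _)) ?compA.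
rewrite ?compA -pentagon !fuL ?compA bpr_bal; congr (_ ∘ _).
Qed.

Definition basc_mor X Y Z :
    hom (btens (btens X Y) Z) (btens X (btens Y Z)) :=
  coeq_desc cq (basc2_proof X Y Z).

Lemma basc_morE X Y Z :
  basc_mor X Y Z ∘ bpr (btens X Y) Z ∘ (bpr X Y ▷ Z)
  = bpr X (btens Y Z) ∘ (X ◁ bpr Y Z) ∘ asc X Y Z.
Proof. by rewrite (rw2 _ (coeq_descE _ _)) ?compA basc1E. Qed.

Lemma bpr2_epi X Y Z : epi (bpr (btens X Y) Z ∘ (bpr X Y ▷ Z)).
Proof. by apply: epi_comp; [exact: bpr_epiR | exact: bpr_epi]. Qed.

Lemma bpr2_epi' X Y Z : epi (bpr X (btens Y Z) ∘ (X ◁ bpr Y Z)).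
Proof. by apply: epi_comp; [exact: bpr_epiL | exact: bpr_epi]. Qed.

Lemma basc_mor_l X Y Z :
  basc_mor X Y Z ∘ la (btens (btens X Y) Z)
  = la (btens X (btens Y Z)) ∘ (A ◁ basc_mor X Y Z).
Proof.
apply: (epiL cl (@bpr2_epi X Y Z)).
rewrite ?compA -[(A ◁ basc_mor _ _ _) ∘ _]whL basc_morE !whL /=.
rewrite (rw2 _ (btens_laE _ _)) ?compA (rw2 _ (btens_laE X (btens Y Z))) ?compA /=.
rewrite asciM fuR btens_laE (rw2 _ (asciL _ _ _)) ?compA !whR ?compA.
rewrite (rw3 _ (basc_morE _ _ _)) ?compA (rw2 _ (ascR _ _ _)) ?compA.
by rewrite penta3 (rw2 _ (eq_sym (xch _ _))) ?compA.
Qed.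

Lemma basc_mor_r X Y Z :
  basc_mor X Y Z ∘ ra (btens (btens X Y) Z)
  = ra (btens X (btens Y Z)) ∘ (basc_mor X Y Z ▷ A).
Proof.
apply: (epiR cl (@bpr2_epi X Y Z)).
rewrite ?compA -[(basc_mor _ _ _ ▷ A) ∘ _]whR basc_morE !whR /=.
rewrite (rw2 _ (btens_raE _ _)) ?compA (rw2 _ (btens_raE X (btens Y Z))) ?compA /=.
rewrite ascR (rw2 _ (xch _ _)) ?compA (rw2 _ (ascM _ _ _)) ?compA.
rewrite (rw3 _ (basc_morE _ _ _)) ?compA fuL btens_raE (rw2 _ (ascL _ _ _)) ?compA.
by rewrite !whL ?compA pentagon.
Qed.

Definition basc X Y Z : bimodule_hom (btens (btens X Y) Z) (btens X (btens Y Z)) :=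
  @BimoduleHom C A (btens (btens X Y) Z) (btens X (btens Y Z)) (basc_mor X Y Z)
    (basc_mor_l X Y Z) (basc_mor_r X Y Z).

Lemma basci1_proof X Y Z :
  (bpr (btens X Y) Z ∘ (bpr X Y ▷ Z) ∘ asci X Y Z) ∘ (X ◁ (ra Y ▷ Z)) =
  (bpr (btens X Y) Z ∘ (bpr X Y ▷ Z) ∘ asci X Y Z) ∘
    (X ◁ ((Y ◁ la Z) ∘ asc Y A Z)).
Proof.
rewrite !whL ?compA asciM (rw2 _ (asciL _ _ _)) ?compA.
rewrite (rw2 _ (eq_sym (xch _ _))) ?compA.
rewrite -penta3 (rw2 _ (eq_sym (ascR _ _ _))) ?compA.
rewrite (rw3 _ (eq_sym (bpr_bal (btens X Y) Z))) ?compA /=.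
by rewrite !fuR ?compA (rw2 _ (btens_raE _ _)) ?compA asciK id_r.
Qed.

Definition basci1 X Y Z : hom (X ⊗ btens Y Z) (btens (btens X Y) Z) :=
  descL cl cq (basci1_proof X Y Z).

Lemma basci1E X Y Z :
  basci1 X Y Z ∘ (X ◁ bpr Y Z)
  = bpr (btens X Y) Z ∘ (bpr X Y ▷ Z) ∘ asci X Y Z.
Proof. exact: descLE. Qed.

Lemma basci2_proof X Y Z :
  basci1 X Y Z ∘ (ra X ▷ btens Y Z)
  = basci1 X Y Z ∘ (X ◁ la (btens Y Z)) ∘ asc X A (btens Y Z).
Proof.
apply: (bpr_epiL (Z := X ⊗ A)); rewrite /= ?compA -xch ascL fuL btens_laE.
rewrite !whL ?compA (rw2 _ (basci1E _ _ _)) ?compA asciR fuR bpr_bal !whR ?compA.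
by rewrite (rw2 _ (basci1E _ _ _)) ?compA (rw2 _ (asciM _ _ _)) ?compA penta4.
Qed.

Definition basci_mor X Y Z :
    hom (btens X (btens Y Z)) (btens (btens X Y) Z) :=
  coeq_desc cq (basci2_proof X Y Z).

Lemma basci_morE X Y Z :
  basci_mor X Y Z ∘ bpr X (btens Y Z) ∘ (X ◁ bpr Y Z)
  = bpr (btens X Y) Z ∘ (bpr X Y ▷ Z) ∘ asci X Y Z.
Proof. by rewrite (rw2 _ (coeq_descE _ _)) ?compA basci1E. Qed.

Lemma basc_morK X Y Z : basci_mor X Y Z ∘ basc_mor X Y Z = idm _.
Proof.
apply: (@bpr2_epi X Y Z).
by rewrite ?compA basc_morE (rw3 _ (basci_morE _ _ _)) ?compA ascK id_l id_r.
Qed.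

Lemma basci_morK X Y Z : basc_mor X Y Z ∘ basci_mor X Y Z = idm _.
Proof.
apply: (@bpr2_epi' X Y Z).
by rewrite ?compA basci_morE (rw3 _ (basc_morE _ _ _)) ?compA asciK id_l id_r.
Qed.

Lemma bim_inv_l X Y (f : bimodule_hom X Y) (g : hom (bcar Y) (bcar X)) :
  g ∘ f = idm _ -> bmor f ∘ g = idm _ -> g ∘ la Y = la X ∘ (A ◁ g).
Proof.
move=> gf fg; apply: (iso_epi (whL_iso A fg)).
by rewrite ?compA -bmor_l (rw2 _ gf) (whL_iso _ gf) id_l id_r.
Qed.

Lemma bim_inv_r X Y (f : bimodule_hom X Y) (g : hom (bcar Y) (bcar X)) :
  g ∘ f = idm _ -> bmor f ∘ g = idm _ -> g ∘ ra Y = ra X ∘ (g ▷ A).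
Proof.
move=> gf fg; apply: (iso_epi (whR_iso A fg)).
by rewrite ?compA -bmor_r (rw2 _ gf) (whR_iso _ gf) id_l id_r.
Qed.

Definition bim_inv X Y (f : bimodule_hom X Y) (g : hom (bcar Y) (bcar X))
    (gf : g ∘ f = idm _) (fg : bmor f ∘ g = idm _) : bimodule_hom Y X :=
  BimoduleHom (bim_inv_l gf fg) (bim_inv_r gf fg).

Definition basci X Y Z :
    bimodule_hom (btens X (btens Y Z)) (btens (btens X Y) Z) :=
  @bim_inv _ _ (basc X Y Z) (basci_mor X Y Z) (basc_morK X Y Z) (basci_morK X Y Z).

Lemma blun_proof X : la X ∘ (ra regular ▷ X) = la X ∘ (regular ◁ la X) ∘ asc A A X.
Proof. exact: laA. Qed.

Definition blun_mor X : hom (btens regular X) X := coeq_desc cq (blun_proof X).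

Lemma blun_morE X : blun_mor X ∘ bpr regular X = la X.
Proof. exact: coeq_descE. Qed.

Lemma blun_mor_l X : blun_mor X ∘ la (btens regular X) = la X ∘ (A ◁ blun_mor X).
Proof.
apply: (bpr_epiL (Z := A)); rewrite /= ?compA -whL blun_morE (btens_laE regular X) /=.
by rewrite (rw2 _ (blun_morE X)) ?compA (rw2 _ (laA X)) ?compA asciK id_r.
Qed.

Lemma blun_mor_r X : blun_mor X ∘ ra (btens regular X) = ra X ∘ (blun_mor X ▷ A).
Proof.
apply: (bpr_epiR (Z := A)); rewrite /= ?compA -whR blun_morE (btens_raE regular X) /=.
by rewrite (rw2 _ (blun_morE X)) ?compA lraA.
Qed.

Definition blun X : bimodule_hom (btens regular X) X :=
  @BimoduleHom C A (btens regular X) X (blun_mor X) (blun_mor_l X) (blun_mor_r X).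

Definition bluni_mor X : hom X (btens regular X) :=
  bpr regular X ∘ (one A ▷ X) ∘ luni X.

Lemma bluni_morK X : blun_mor X ∘ bluni_mor X = idm _.
Proof. by rewrite /bluni_mor (rw2 _ (blun_morE X)) ?compA (rw2 _ (la1 _)) ?compA luniK. Qed.

Lemma blun_morK X : bluni_mor X ∘ blun_mor X = idm _.
Proof.
apply: (@bpr_epi regular X).
rewrite ?compA blun_morE /bluni_mor ?compA luni_nat (rw2 _ (eq_sym (xch _ _))) ?compA.
have := bpr_bal regular X; rewrite /= => e.
have e' : bpr regular X ∘ (A ◁ la X) = bpr regular X ∘ (mul A ▷ X) ∘ asci A A X.
  by rewrite (rw2 _ e) ?compA asciK id_r.
rewrite (rw2 _ e') ?compA (rw2 _ (asciR _ _ _)) ?compA fuR mul1l.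
by rewrite (rw2 _ (lun_asci _ _)) ?compA luniK id_r id_l.
Qed.

Definition bluni X : bimodule_hom X (btens regular X) :=
  @bim_inv _ _ (blun X) (bluni_mor X) (blun_morK X) (bluni_morK X).

Lemma brun_proof X : ra X ∘ (ra X ▷ regular) = ra X ∘ (X ◁ la regular) ∘ asc X A A.
Proof. exact: raA. Qed.

Definition brun_mor X : hom (btens X regular) X := coeq_desc cq (brun_proof X).

Lemma brun_morE X : brun_mor X ∘ bpr X regular = ra X.
Proof. exact: coeq_descE. Qed.

Lemma brun_mor_l X : brun_mor X ∘ la (btens X regular) = la X ∘ (A ◁ brun_mor X).
Proof.
apply: (bpr_epiL (Z := A)); rewrite /= ?compA -whL brun_morE (btens_laE X regular) /=.
by rewrite (rw2 _ (brun_morE X)) ?compA (rw2 _ (lraA X)) ?compA asciK id_r.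
Qed.

Lemma brun_mor_r X : brun_mor X ∘ ra (btens X regular) = ra X ∘ (brun_mor X ▷ A).
Proof.
apply: (bpr_epiR (Z := A)); rewrite /= ?compA -whR brun_morE (btens_raE X regular) /=.
by rewrite (rw2 _ (brun_morE X)) ?compA raA.
Qed.

Definition brun X : bimodule_hom (btens X regular) X :=
  @BimoduleHom C A (btens X regular) X (brun_mor X) (brun_mor_l X) (brun_mor_r X).

Definition bruni_mor X : hom X (btens X regular) :=
  bpr X regular ∘ (X ◁ one A) ∘ runi X.

Lemma bruni_morK X : brun_mor X ∘ bruni_mor X = idm _.
Proof. by rewrite /bruni_mor (rw2 _ (brun_morE X)) ?compA (rw2 _ (ra1 _)) ?compA runiK. Qed.

Lemma brun_morK X : bruni_mor X ∘ brun_mor X = idm _.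
Proof.
apply: (@bpr_epi X regular).
rewrite ?compA brun_morE /bruni_mor ?compA runi_nat (rw2 _ (xch _ _)) ?compA.
have := bpr_bal X regular; rewrite /= => e.
rewrite (rw2 _ e) ?compA (rw2 _ (ascL _ _ _)) ?compA fuL mul1r.
by rewrite (rw2 _ (run_asc _ _)) ?compA runiK id_r id_l.
Qed.

Definition bruni X : bimodule_hom X (btens X regular) :=
  @bim_inv _ _ (brun X) (bruni_mor X) (brun_morK X) (bruni_morK X).

Lemma btens_mor_id X Y : btens_mor (bim_id X) (bim_id Y) = idm _.
Proof. by apply: bpr_epi; rewrite btens_morE /= tensh_id id_l id_r. Qed.

Lemma btens_mor_comp X X' X'' Y Y' Y''
    (f' : bimodule_hom X' X'') (f : bimodule_hom X X')
    (g' : bimodule_hom Y' Y'') (g : bimodule_hom Y Y') :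
  btens_mor (bim_comp f' f) (bim_comp g' g) = btens_mor f' g' ∘ btens_mor f g.
Proof.
apply: bpr_epi; rewrite btens_morE /= tensh_comp ?compA btens_morE.
by rewrite (rw2 _ (btens_morE _ _)) ?compA.
Qed.

Lemma basc_mor_nat X X' Y Y' Z Z'
    (f : bimodule_hom X X') (g : bimodule_hom Y Y') (h : bimodule_hom Z Z') :
  basc_mor X' Y' Z' ∘ btens_mor (btens_hom f g) h
  = btens_mor f (btens_hom g h) ∘ basc_mor X Y Z.
Proof.
apply: (@bpr2_epi X Y Z).
rewrite ?compA basc_morE (rw2 _ (btens_morE _ _)) ?compA (rw2 _ (btens_morE f _)) ?compA.
rewrite -tensh_comp (rw2 _ (eq_sym (tensh_comp _ _ _ _))) ?compA /= btens_morE btens_morE.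
rewrite !id_r -[bmor f in RHS]id_l -[bmor h in LHS]id_l !tensh_comp.
by rewrite (rw3 _ (basc_morE _ _ _)) ?compA asc_nat.
Qed.

Lemma blun_mor_nat X Y (f : bimodule_hom X Y) :
  blun_mor Y ∘ btens_mor (bim_id regular) f = f ∘ blun_mor X.
Proof.
apply: (@bpr_epi regular X).
by rewrite ?compA btens_morE (rw2 _ (blun_morE Y)) ?compA blun_morE bmor_l.
Qed.

Lemma brun_mor_nat X Y (f : bimodule_hom X Y) :
  brun_mor Y ∘ btens_mor f (bim_id regular) = f ∘ brun_mor X.
Proof.
apply: (@bpr_epi X regular).
by rewrite ?compA btens_morE (rw2 _ (brun_morE Y)) ?compA brun_morE bmor_r.
Qed.

Lemma bpentagon X Y Z W :
  btens_mor (bim_id X) (basc Y Z W) ∘ basc_mor X (btens Y Z) W ∘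
    btens_mor (basc X Y Z) (bim_id W)
  = basc_mor X Y (btens Z W) ∘ basc_mor (btens X Y) Z W.
Proof.
apply: (epi_comp (epiR cl (@bpr2_epi X Y Z)) (@bpr_epi (btens (btens X Y) Z) W)).
rewrite ?compA (rw2 _ (btens_morE (basc X Y Z) _)) ?compA /= ?compA -whR basc_morE.
rewrite !whR (rw3 _ (basc_morE X (btens Y Z) W)) ?compA.
rewrite (rw2 _ (btens_morE _ (basc Y Z W))) ?compA (rw2 _ (ascM _ _ _)) ?compA /=.
rewrite !fuL ?compA basc_morE !whL ?compA pentagon.
rewrite (rw3 _ (basc_morE (btens X Y) Z W)) ?compA ascR.
rewrite (rw2 _ (xch _ _)) ?compA (rw3 _ (basc_morE X Y (btens Z W))) ?compA.
by rewrite (rw2 _ (ascL _ _ _)) ?compA.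
Qed.

Lemma btriangle X Y :
  btens_mor (bim_id X) (blun Y) ∘ basc_mor X regular Y
  = btens_mor (brun X) (bim_id Y).
Proof.
apply: (@bpr2_epi X regular Y).
rewrite ?compA basc_morE (rw2 _ (btens_morE _ (blun Y))) ?compA /= ?compA fuL blun_morE.
rewrite (rw2 _ (btens_morE (brun X) _)) ?compA /= ?compA -whR brun_morE.
by rewrite bpr_bal.
Qed.

Program Definition bimod : monoidal :=
  @Monoidal bimod_cat regular btens btens_hom basc basci blun bluni brun bruni
    _ _ _ _ _ _ _ _ _ _ _ _ _.
Next Obligation. by move=> *; apply: bmor_inj; exact: btens_mor_id. Qed.
Next Obligation. by move=> *; apply: bmor_inj; exact: btens_mor_comp. Qed.
Next Obligation. by move=> *; apply: bmor_inj; exact: basc_morK. Qed.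
Next Obligation. by move=> *; apply: bmor_inj; exact: basci_morK. Qed.
Next Obligation. by move=> *; apply: bmor_inj; exact: blun_morK. Qed.
Next Obligation. by move=> *; apply: bmor_inj; exact: bluni_morK. Qed.
Next Obligation. by move=> *; apply: bmor_inj; exact: brun_morK. Qed.
Next Obligation. by move=> *; apply: bmor_inj; exact: bruni_morK. Qed.
Next Obligation. by move=> *; apply: bmor_inj; exact: basc_mor_nat. Qed.
Next Obligation. by move=> *; apply: bmor_inj; exact: blun_mor_nat. Qed.
Next Obligation. by move=> *; apply: bmor_inj; exact: brun_mor_nat. Qed.
Next Obligation. by move=> *; apply: bmor_inj; exact: bpentagon. Qed.
Next Obligation. by move=> *; apply: bmor_inj; exact: btriangle. Qed.

End Bimodules.

Program Definition full_sub_cat (V : category) (P : V -> Prop) : category :=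
  @Category {X : V | P X} (fun X Y => hom (proj1_sig X) (proj1_sig Y))
    (fun X => idm (proj1_sig X)) (fun X Y Z g f => g ∘ f) _ _ _.
Next Obligation. by move=> *; exact: compA. Qed.
Next Obligation. by move=> *; exact: id_l. Qed.
Next Obligation. by move=> *; exact: id_r. Qed.

Section FullSub.
Context (V : monoidal) (P : V -> Prop).
Context (P1 : P 𝟙) (Pt : forall X Y : V, P X -> P Y -> P (X ⊗ Y)).

Program Definition full_sub : monoidal :=
  @Monoidal (full_sub_cat P) (exist P 𝟙 P1)
    (fun X Y => exist P (proj1_sig X ⊗ proj1_sig Y) (Pt (proj2_sig X) (proj2_sig Y)))
    (fun X X' Y Y' f g => @tensh V _ _ _ _ f g)
    (fun X Y Z => asc (proj1_sig X) (proj1_sig Y) (proj1_sig Z))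
    (fun X Y Z => asci (proj1_sig X) (proj1_sig Y) (proj1_sig Z))
    (fun X => lun (proj1_sig X)) (fun X => luni (proj1_sig X))
    (fun X => run (proj1_sig X)) (fun X => runi (proj1_sig X))
    _ _ _ _ _ _ _ _ _ _ _ _ _.
Next Obligation. by move=> *; exact: tensh_id. Qed.
Next Obligation. by move=> *; exact: tensh_comp. Qed.
Next Obligation. by move=> *; exact: ascK. Qed.
Next Obligation. by move=> *; exact: asciK. Qed.
Next Obligation. by move=> *; exact: lunK. Qed.
Next Obligation. by move=> *; exact: luniK. Qed.
Next Obligation. by move=> *; exact: runK. Qed.
Next Obligation. by move=> *; exact: runiK. Qed.
Next Obligation. by move=> *; exact: asc_nat. Qed.
Next Obligation. by move=> *; exact: lun_nat. Qed.
Next Obligation. by move=> *; exact: run_nat. Qed.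
Next Obligation. by move=> *; exact: pentagon. Qed.
Next Obligation. by move=> *; exact: triangle. Qed.

End FullSub.

(* Transport of a monoidal structure along a fully faithful functor [F], given
   objects [u] and [t X Y] whose images are isomorphic to the unit and to the
   tensor product of the images. *)
Section Transport.
Context (V : monoidal) (D : category) (F : D -> V).
Context (Fh : forall X Y : D, hom X Y -> hom (F X) (F Y)).
Context (Fi : forall X Y : D, hom (F X) (F Y) -> hom X Y).
Context (Fh_id : forall X : D, Fh (idm X) = idm (F X)).
Context (Fh_comp : forall (X Y Z : D) (g : hom Y Z) (f : hom X Y),
  Fh (g ∘ f) = Fh g ∘ Fh f).
Context (FhK : forall (X Y : D) (f : hom X Y), Fi (Fh f) = f).
Context (FiK : forall (X Y : D) (f : hom (F X) (F Y)), Fh (Fi f) = f).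
Context (u : D) (t : D -> D -> D).
Context (e : hom 𝟙 (F u)) (ei : hom (F u) 𝟙).
Context (eK : ei ∘ e = idm _) (eiK : e ∘ ei = idm _).
Context (m : forall X Y : D, hom (F X ⊗ F Y) (F (t X Y))).
Context (mi : forall X Y : D, hom (F (t X Y)) (F X ⊗ F Y)).
Context (mK : forall X Y : D, mi X Y ∘ m X Y = idm _).
Context (miK : forall X Y : D, m X Y ∘ mi X Y = idm _).

Lemma Fh_inj (X Y : D) (f g : hom X Y) : Fh f = Fh g -> f = g.
Proof. by move=> E; rewrite -(FhK f) -(FhK g) E. Qed.

Let teh (X X' Y Y' : D) (f : hom X X') (g : hom Y Y') : hom (t X Y) (t X' Y') :=
  Fi (m X' Y' ∘ (Fh f ⊠ Fh g) ∘ mi X Y).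
Let tasc (X Y Z : D) : hom (t (t X Y) Z) (t X (t Y Z)) :=
  Fi (m X (t Y Z) ∘ (F X ◁ m Y Z) ∘ asc (F X) (F Y) (F Z) ∘ (mi X Y ▷ F Z) ∘
      mi (t X Y) Z).
Let tasci (X Y Z : D) : hom (t X (t Y Z)) (t (t X Y) Z) :=
  Fi (m (t X Y) Z ∘ (m X Y ▷ F Z) ∘ asci (F X) (F Y) (F Z) ∘ (F X ◁ mi Y Z) ∘
      mi X (t Y Z)).
Let tlun (X : D) : hom (t u X) X := Fi (lun (F X) ∘ (ei ▷ F X) ∘ mi u X).
Let tluni (X : D) : hom X (t u X) := Fi (m u X ∘ (e ▷ F X) ∘ luni (F X)).
Let trun (X : D) : hom (t X u) X := Fi (run (F X) ∘ (F X ◁ ei) ∘ mi X u).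
Let truni (X : D) : hom X (t X u) := Fi (m X u ∘ (F X ◁ e) ∘ runi (F X)).

Program Definition transport : monoidal :=
  @Monoidal D u t teh tasc tasci tlun tluni trun truni
    _ _ _ _ _ _ _ _ _ _ _ _ _.
Next Obligation.
by move=> X Y; apply: Fh_inj; rewrite FiK !Fh_id tensh_id id_l miK.
Qed.
Next Obligation.
move=> X X' X'' Y Y' Y'' f' f g' g; apply: Fh_inj.
by rewrite Fh_comp !FiK !Fh_comp tensh_comp ?compA (rw2 _ (mK _ _)) id_l.
Qed.
Next Obligation.
move=> X Y Z; apply: Fh_inj; rewrite Fh_comp !FiK ?compA Fh_id.
rewrite (rw2 _ (mK _ _)) id_l (rw2 _ (whL_iso _ (mK _ _))) id_l.
rewrite (rw2 _ (ascK _ _ _)) id_l (rw2 _ (whR_iso _ (miK _ _))) id_l.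
by rewrite miK.
Qed.
Next Obligation.
move=> X Y Z; apply: Fh_inj; rewrite Fh_comp !FiK ?compA Fh_id.
rewrite (rw2 _ (mK _ _)) id_l (rw2 _ (whR_iso _ (mK _ _))) id_l.
rewrite (rw2 _ (asciK _ _ _)) id_l (rw2 _ (whL_iso _ (miK _ _))) id_l.
by rewrite miK.
Qed.
Next Obligation.
move=> X; apply: Fh_inj; rewrite Fh_comp !FiK ?compA Fh_id.
rewrite (rw2 _ (lunK _)) id_l (rw2 _ (whR_iso _ eiK)) id_l.
by rewrite miK.
Qed.
Next Obligation.
move=> X; apply: Fh_inj; rewrite Fh_comp !FiK ?compA Fh_id.
rewrite (rw2 _ (mK _ _)) id_l (rw2 _ (whR_iso _ eK)) id_l.
by rewrite luniK.
Qed.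
Next Obligation.
move=> X; apply: Fh_inj; rewrite Fh_comp !FiK ?compA Fh_id.
rewrite (rw2 _ (runK _)) id_l (rw2 _ (whL_iso _ eiK)) id_l.
by rewrite miK.
Qed.
Next Obligation.
move=> X; apply: Fh_inj; rewrite Fh_comp !FiK ?compA Fh_id.
rewrite (rw2 _ (mK _ _)) id_l (rw2 _ (whL_iso _ eK)) id_l.
by rewrite runiK.
Qed.
Next Obligation.
move=> X X' Y Y' Z Z' f g h; apply: Fh_inj; rewrite !Fh_comp !FiK ?compA.
rewrite (rw2 _ (mK _ _)) id_l (rw2 _ (mK X (t Y Z))) id_l.
rewrite (rw2 _ (eq_sym (tensh_comp (mi X' Y') _ _ _))) id_l ?compA.
rewrite (rw2 _ (eq_sym (tensh_comp (Fh f) _ _ _))) id_r ?compA mK id_r.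
rewrite (rw2 _ (mK _ _)) id_l -[Fh h in LHS]id_r -[Fh f in RHS]id_l !tensh_comp.
by rewrite ?compA (rw2 _ (asc_nat _ _ _)) ?compA.
Qed.
Next Obligation.
move=> X Y f; apply: Fh_inj; rewrite !Fh_comp !FiK ?compA !Fh_id.
rewrite (rw2 _ (mK _ _)) id_l (rw2 _ (eq_sym (xch _ _))) ?compA.
by rewrite (rw2 _ (lun_nat _)) ?compA.
Qed.
Next Obligation.
move=> X Y f; apply: Fh_inj; rewrite !Fh_comp !FiK ?compA !Fh_id.
rewrite (rw2 _ (mK _ _)) id_l (rw2 _ (xch _ _)) ?compA.
by rewrite (rw2 _ (run_nat _)) ?compA.
Qed.
Next Obligation.
move=> X Y Z W; apply: Fh_inj; rewrite !Fh_comp !FiK ?compA !Fh_id.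
do 3!rewrite (rw2 _ (mK _ _)) id_l.
rewrite !whL !whR ?compA (rw2 _ (whL_iso _ (mK _ _))) id_l.
rewrite (rw2 _ (whR_iso _ (mK _ _))) id_l (rw2 _ (ascM _ _ _)) ?compA.
rewrite (rw2 _ (whL_iso _ (whR_iso _ (mK _ _)))) id_l (rw3 _ (pentagon _ _ _ _)) ?compA.
rewrite (rw2 _ (eq_sym (xch (mi X Y) _))) ?compA (rw2 _ (ascL _ _ _)) ?compA.
by rewrite (rw2 _ (eq_sym (ascR _ _ _))) ?compA.
Qed.
Next Obligation.
move=> X Y; apply: Fh_inj; rewrite !Fh_comp !FiK ?compA !Fh_id.
rewrite (rw2 _ (mK _ _)) id_l !whL !whR ?compA (rw2 _ (whL_iso _ (mK _ _))) id_l.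
by rewrite (rw2 _ (eq_sym (ascM _ _ _))) ?compA (rw2 _ (triangle _ _)).
Qed.

End Transport.

Record lax_half_braiding (C : monoidal) (A : C) := LaxHalfBraiding {
  hb : forall Y : C, hom (A ⊗ Y) (Y ⊗ A);
  hb_nat : forall (Y Z : C) (f : hom Y Z), hb Z ∘ (A ◁ f) = (f ▷ A) ∘ hb Y;
  hb_unit : hb 𝟙 = luni A ∘ run A;
  hb_tens : forall Y Z : C,
    hb (Y ⊗ Z) = asci Y Z A ∘ (Y ◁ hb Z) ∘ asc Y A Z ∘ (hb Y ▷ Z) ∘ asci A Y Z
}.

Arguments hb {C A} l Y.

Record lax_central_commutative (C : monoidal) (A : algebra C)
    (s : lax_half_braiding A) : Prop := LaxCentralCommutative {
  lcc_mul : forall X : C,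
    hb s X ∘ (mul A ▷ X)
    = (X ◁ mul A) ∘ asc X A A ∘ (hb s X ▷ A) ∘ asci A X A ∘ (A ◁ hb s X) ∘
      asc A A X;
  lcc_one : forall X : C, hb s X ∘ (one A ▷ X) = (X ◁ one A) ∘ runi X ∘ lun X;
  lcc_comm : mul A ∘ hb s A = mul A
}.

Definition in_sigma (C : monoidal) (A : algebra C) (s : lax_half_braiding A)
  (X : bimodule A) : Prop := la X = ra X ∘ hb s X.

Record rmodule (C : monoidal) (A : algebra C) := RModule {
  rcar :> C;
  rra : hom (rcar ⊗ A) rcar;
  rraA : rra ∘ (rra ▷ A) = rra ∘ (rcar ◁ mul A) ∘ asc rcar A A;
  rra1 : rra ∘ (rcar ◁ one A) = run rcar
}.

Arguments rra {C A} r.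

Record rmodule_hom (C : monoidal) (A : algebra C) (M N : rmodule A) :=
    RModuleHom {
  rmor :> hom (rcar M) (rcar N);
  rmor_r : rmor ∘ rra M = rra N ∘ (rmor ▷ A)
}.

Section RightModules.
Context (C : monoidal) (A : algebra C).
Implicit Types M N L : rmodule A.

Lemma rmor_inj M N (f g : rmodule_hom M N) : rmor f = rmor g -> f = g.
Proof.
case: f g => [f fr] [g gr] /= e; case: g / e gr => gr.
by rewrite (proof_irrelevance _ fr gr).
Qed.

Program Definition rmod_id M : rmodule_hom M M := @RModuleHom _ _ M M (idm _) _.
Next Obligation. by move=> M; rewrite tensh_id id_l id_r. Qed.

Program Definition rmod_comp M N L (g : rmodule_hom N L) (f : rmodule_hom M N) :
  rmodule_hom M L := @RModuleHom _ _ M L (rmor g ∘ rmor f) _.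
Next Obligation.
by move=> M N L g f; rewrite compA rmor_r (rw2 _ (rmor_r g)) ?compA whR ?compA.
Qed.

Program Definition rmod_cat : category :=
  @Category (rmodule A) (@rmodule_hom C A) rmod_id rmod_comp _ _ _.
Next Obligation. by move=> *; apply: rmor_inj; rewrite /= compA. Qed.
Next Obligation. by move=> *; apply: rmor_inj; rewrite /= id_l. Qed.
Next Obligation. by move=> *; apply: rmor_inj; rewrite /= id_r. Qed.

Definition to_rmod (X : bimodule A) : rmodule A := RModule (raA X) (ra1 X).

Definition to_rmod_hom (X Y : bimodule A) (f : bimodule_hom X Y) :
    rmodule_hom (to_rmod X) (to_rmod Y) :=
  @RModuleHom C A (to_rmod X) (to_rmod Y) f (bmor_r f).

End RightModules.

Section SigmaModules.
Context (C : monoidal) (cl : closed C) (cq : coequalizers C) (A : algebra C).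
Context (s : lax_half_braiding A) (hs : lax_central_commutative s).

Lemma in_sigma_regular : in_sigma s (regular A).
Proof. by rewrite /in_sigma /= (lcc_comm hs). Qed.

Lemma in_sigma_tens (X Y : bimodule A) :
  in_sigma s X -> in_sigma s Y -> in_sigma s (btens cl cq X Y).
Proof.
rewrite /in_sigma => hX hY; apply: (bpr_epiL cl (Z := A)).
rewrite /= compA hb_nat (rw2 _ (btens_raE _ _ _ _)) ?compA btens_laE ?compA hb_tens.
rewrite (rw2 _ (asciK _ _ _)) ?compA id_l hX whR ?compA (rw2 _ (bpr_bal _ _ _)) ?compA.
by rewrite hY whL ?compA.
Qed.

(* The category C_A^σ. *)
Definition sigma_mod : monoidal :=
  @full_sub (bimod A cl cq) (in_sigma s) in_sigma_regular in_sigma_tens.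

Section ToBimodule.
Context (M : rmodule A).

Lemma sbim_lraA :
  rra M ∘ ((rra M ∘ hb s M) ▷ A)
  = (rra M ∘ hb s M) ∘ (A ◁ rra M) ∘ asc A M A.
Proof.
rewrite whR ?compA (rw2 _ (hb_nat s (rra M))) ?compA hb_tens ?compA ascK id_r.
rewrite (rw2 _ (rraA M)) ?compA (rw2 _ (rraA M)) ?compA (rw2 _ (asciK _ _ _)) ?compA id_l.
by rewrite fuL (lcc_comm hs).
Qed.

Lemma sbim_laA :
  (rra M ∘ hb s M) ∘ (mul A ▷ M)
  = (rra M ∘ hb s M) ∘ (A ◁ (rra M ∘ hb s M)) ∘ asc A A M.
Proof.
have := sbim_lraA; rewrite ?compA => e.
have e' : rra M ∘ hb s M ∘ (A ◁ rra M) = rra M ∘ ((rra M ∘ hb s M) ▷ A) ∘ asci A M A.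
  by rewrite (rw2 _ e) ?compA asciK id_r.
rewrite !whL ?compA (rw3 _ e') ?compA (lcc_mul hs) whR ?compA.
by rewrite (rw2 _ (rraA M)) ?compA.
Qed.

Lemma sbim_la1 : (rra M ∘ hb s M) ∘ (one A ▷ M) = lun M.
Proof.
by rewrite ?compA (lcc_one hs) (rw2 _ (rra1 M)) ?compA (rw2 _ (runiK _)) ?compA id_l.
Qed.

Definition sbim : bimodule A :=
  Bimodule sbim_laA sbim_la1 (rraA M) (rra1 M) sbim_lraA.

End ToBimodule.

Lemma sbim_hom_l (M N : rmodule A) (f : rmodule_hom M N) :
  rmor f ∘ la (sbim M) = la (sbim N) ∘ (A ◁ f).
Proof. by rewrite /= compA hb_nat (rw2 _ (rmor_r f)) ?compA. Qed.

Definition sbim_hom (M N : rmodule A) (f : rmodule_hom M N) :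
    bimodule_hom (sbim M) (sbim N) :=
  @BimoduleHom C A (sbim M) (sbim N) f (sbim_hom_l f) (rmor_r f).

Definition of_sbim_hom (M N : rmodule A) (f : bimodule_hom (sbim M) (sbim N)) :
    rmodule_hom M N :=
  @RModuleHom C A M N f (bmor_r f).

Definition sig_obj (M : rmodule A) : sigma_mod :=
  exist (in_sigma s) (sbim M) (eq_refl (rra M ∘ hb s M)).

Lemma sig_iso_l (X : sigma_mod) :
  idm _ ∘ la (proj1_sig X)
  = la (sbim (to_rmod (proj1_sig X))) ∘ (A ◁ idm (bcar (proj1_sig X))).
Proof. by rewrite id_l tensh_id id_r; exact: (proj2_sig X). Qed.

Lemma sig_iso_r (X : sigma_mod) :
  idm _ ∘ ra (proj1_sig X)
  = ra (sbim (to_rmod (proj1_sig X))) ∘ (idm (bcar (proj1_sig X)) ▷ A).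
Proof. by rewrite id_l tensh_id id_r. Qed.

Definition sig_iso (X : sigma_mod) :
    @hom sigma_mod X (sig_obj (to_rmod (proj1_sig X))) :=
  @BimoduleHom C A (proj1_sig X) (sbim (to_rmod (proj1_sig X)))
    (idm _) (sig_iso_l X) (sig_iso_r X).

Definition sig_isoi (X : sigma_mod) :
    @hom sigma_mod (sig_obj (to_rmod (proj1_sig X))) X :=
  @bim_inv _ _ _ _ (sig_iso X) (idm _) (id_l _) (id_l _).

(* Right A-modules with the monoidal structure of C_A^σ: a right module [M] is
   identified with the bimodule [sbim M] whose left action is determined by [s]. *)
Program Definition sigma_rmod : monoidal :=
  @transport sigma_mod (rmod_cat A) sig_obj sbim_hom of_sbim_hom
    _ _ _ _
    (to_rmod (regular A)) (fun M N => to_rmod (btens cl cq (sbim M) (sbim N)))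
    (sig_iso 𝟙) (sig_isoi 𝟙) _ _
    (fun M N => sig_iso (sig_obj M ⊗ sig_obj N))
    (fun M N => sig_isoi (sig_obj M ⊗ sig_obj N)) _ _.
Next Obligation. by move=> *; apply: bmor_inj. Qed.
Next Obligation. by move=> *; apply: bmor_inj. Qed.
Next Obligation. by move=> *; apply: rmor_inj. Qed.
Next Obligation. by move=> *; apply: bmor_inj. Qed.
Next Obligation. by move=> *; apply: bmor_inj; exact: id_l. Qed.
Next Obligation. by move=> *; apply: bmor_inj; exact: id_l. Qed.
Next Obligation. by move=> *; apply: bmor_inj; exact: id_l. Qed.
Next Obligation. by move=> *; apply: bmor_inj; exact: id_l. Qed.

End SigmaModules.

Section Braided.
Context (C : monoidal) (c : braiding C).
Implicit Types X Y Z : C.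

Lemma br_unit_r X : lun X ∘ br c X 𝟙 = run X.
Proof.
apply: whR_inj; rewrite whR.
have cj : forall Y (f g : hom Y (X ⊗ 𝟙)), br c X 𝟙 ∘ f = br c X 𝟙 ∘ g -> f = g.
  by move=> Y f g E; rewrite -(id_l f) -(id_l g) -(brK c) !compA E.
apply: cj; rewrite -(lun_asc X 𝟙) ?compA (rw2 _ (eq_sym (lun_nat _))) ?compA.
rewrite -hexagon1 (rw2 _ (lun_asc _ _)) ?compA (rw2 _ (eq_sym (br_nat c _ _))) ?compA.
by rewrite triangle.
Qed.

Lemma br_unit_l X : run X ∘ br c 𝟙 X = lun X.
Proof.
apply: whL_inj; rewrite whL.
have cj : forall Y (f g : hom Y (𝟙 ⊗ X)), br c 𝟙 X ∘ f = br c 𝟙 X ∘ g -> f = g.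
  by move=> Y f g E; rewrite -(id_l f) -(id_l g) -(brK c) !compA E.
apply: cj; rewrite -(run_asci 𝟙 X) ?compA (rw2 _ (eq_sym (run_nat _))) ?compA.
rewrite -hexagon2 (rw2 _ (run_asci _ _)) ?compA (rw2 _ (eq_sym (br_nat c _ _))) ?compA.
by rewrite triangle_i.
Qed.

Lemma hexagon1' X Y Z :
  br c X (Y ⊗ Z)
  = asci Y Z X ∘ (Y ◁ br c X Z) ∘ asc Y X Z ∘ (br c X Y ▷ Z) ∘ asci X Y Z.
Proof.
by rewrite (rw3 _ (eq_sym (hexagon1 c X Y Z))) ?compA asciK id_r (rw2 _ (ascK _ _ _)) ?compA id_l.
Qed.

Lemma hexagon2' X Y Z :
  br c (X ⊗ Y) Z
  = asc Z X Y ∘ (br c X Z ▷ Y) ∘ asci X Z Y ∘ (X ◁ br c Y Z) ∘ asc X Y Z.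
Proof.
by rewrite (rw3 _ (eq_sym (hexagon2 c X Y Z))) ?compA ascK id_r (rw2 _ (asciK _ _ _)) ?compA id_l.
Qed.

Lemma br_hb_nat (A : C) Y Z (f : hom Y Z) :
  br c A Z ∘ (A ◁ f) = (f ▷ A) ∘ br c A Y.
Proof. exact: br_nat. Qed.

Lemma br_hb_unit (A : C) : br c A 𝟙 = luni A ∘ run A.
Proof. by rewrite -br_unit_r (rw2 _ (lunK A)) ?compA id_l. Qed.

Definition br_lax (A : C) : lax_half_braiding A :=
  LaxHalfBraiding (@br_hb_nat A) (br_hb_unit A) (@hexagon1' A).

Definition commutative (A : algebra C) : Prop := mul A ∘ br c A A = mul A.

Lemma commutative_lcc (A : algebra C) :
  commutative A -> lax_central_commutative (br_lax A).
Proof.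
move=> hA; split => [X | X |]; last exact: hA.
- by rewrite /= br_nat hexagon2' ?compA.
- rewrite /= br_nat; congr (_ ∘ _).
  by rewrite -(br_unit_l X) (rw2 _ (runK X)) ?compA id_l.
Qed.

Definition is_local (A : algebra C) (M : rmodule A) : Prop :=
  rra M ∘ br c A M ∘ br c M A = rra M.

Context (cl : closed C) (cq : coequalizers C) (A : algebra C) (hA : commutative A).

(* The category C_A. *)
Definition mod_A : monoidal := sigma_rmod cl cq (commutative_lcc hA).

Lemma is_local_unit : is_local (𝟙 : mod_A).
Proof. by rewrite /is_local /= (rw2 _ hA). Qed.

Lemma is_local_tens (M N : mod_A) :
  is_local M -> is_local N -> is_local (M ⊗ N).
Proof.
rewrite /is_local => hM hN.
set X := sbim (commutative_lcc hA) M; set Y := sbim (commutative_lcc hA) N.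
have hX : ra X ∘ br c A X ∘ br c X A = ra X by exact: hM.
have hY : la Y ∘ br c Y A = ra Y by rewrite -[RHS]hN /= compA.
rewrite -[rra (M ⊗ N)]/(btens_ra cl cq X Y).
apply: (bpr_epiR cl (Z := A)); rewrite ?compA br_nat (rw2 _ (br_nat c _ _)) ?compA.
rewrite (rw2 _ (btens_raE _ _ _ _)) ?compA btens_raE ?compA hexagon1' hexagon2' ?compA.
rewrite (rw2 _ (asciK _ _ _)) ?compA id_l (rw2 _ (ascK _ _ _)) ?compA id_l !fuR fuL.
rewrite -[ra Y ∘ br c A N]/(la Y).
rewrite (rw3 _ (eq_sym (bpr_bal cq X Y))) ?compA fuR hX.
rewrite (rw2 _ (bpr_bal _ X Y)) ?compA (rw2 _ (asciK _ _ _)) ?compA id_l fuL hY.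
by [].
Qed.

(* The category C_A^loc. *)
Definition loc_mod_A : monoidal :=
  @full_sub mod_A (@is_local A) is_local_unit is_local_tens.

End Braided.

Section InternalHom.
Context (C : monoidal) (cl : closed C) (A : algebra C).
Implicit Types X Y : bimodule A.

Definition hom_la X Y : hom (A ⊗ ihom cl X Y) (ihom cl X Y) :=
  icur cl (la Y ∘ (A ◁ iev cl X Y) ∘ asc A (ihom cl X Y) X).

Definition hom_ra X Y : hom (ihom cl X Y ⊗ A) (ihom cl X Y) :=
  icur cl (iev cl X Y ∘ (ihom cl X Y ◁ la X) ∘ asc (ihom cl X Y) A X).

Lemma hom_laE X Y :
  iev cl X Y ∘ (hom_la X Y ▷ X) = la Y ∘ (A ◁ iev cl X Y) ∘ asc A (ihom cl X Y) X.
Proof. exact: icurE. Qed.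

Lemma hom_raE X Y :
  iev cl X Y ∘ (hom_ra X Y ▷ X)
  = iev cl X Y ∘ (ihom cl X Y ◁ la X) ∘ asc (ihom cl X Y) A X.
Proof. exact: icurE. Qed.

Lemma hom_laA X Y :
  hom_la X Y ∘ (mul A ▷ ihom cl X Y)
  = hom_la X Y ∘ (A ◁ hom_la X Y) ∘ asc A A (ihom cl X Y).
Proof.
apply: (icur_uniq (c := cl)); rewrite !whR ?compA !(rw2 _ (hom_laE X Y)) ?compA.
rewrite ascR (rw2 _ (ascM _ _ _)) ?compA fuL hom_laE (rw2 _ (xch _ _)) ?compA.
by rewrite (rw2 _ (laA Y)) ?compA (rw2 _ (ascL _ _ _)) ?compA !whL ?compA pentagon.
Qed.

Lemma hom_la1 X Y :
  hom_la X Y ∘ (one A ▷ ihom cl X Y) = lun (ihom cl X Y).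
Proof.
apply: (icur_uniq (c := cl)); rewrite !whR (rw2 _ (hom_laE X Y)) ?compA ascR.
by rewrite (rw2 _ (xch _ _)) ?compA (rw2 _ (la1 Y)) ?compA (rw2 _ (lun_nat _)) ?compA lun_asc.
Qed.

Lemma hom_raA X Y :
  hom_ra X Y ∘ (hom_ra X Y ▷ A)
  = hom_ra X Y ∘ (ihom cl X Y ◁ mul A) ∘ asc (ihom cl X Y) A A.
Proof.
apply: (icur_uniq (c := cl)); rewrite !whR ?compA !(rw2 _ (hom_raE X Y)) ?compA.
rewrite ascR (rw2 _ (ascM _ _ _)) ?compA fuL (rw2 _ (xch _ _)) ?compA laA.
rewrite (rw2 _ (hom_raE X Y)) ?compA (rw2 _ (ascL _ _ _)) ?compA !whL ?compA.
by rewrite pentagon.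
Qed.

Lemma hom_ra1 X Y :
  hom_ra X Y ∘ (ihom cl X Y ◁ one A) = run (ihom cl X Y).
Proof.
apply: (icur_uniq (c := cl)); rewrite !whR (rw2 _ (hom_raE X Y)) ?compA ascM.
by rewrite fuL la1 triangle.
Qed.

Lemma hom_lraA X Y :
  hom_ra X Y ∘ (hom_la X Y ▷ A)
  = hom_la X Y ∘ (A ◁ hom_ra X Y) ∘ asc A (ihom cl X Y) A.
Proof.
apply: (icur_uniq (c := cl)); rewrite !whR ?compA (rw2 _ (hom_raE X Y)) ?compA.
rewrite ascR (rw2 _ (xch _ _)) ?compA !(rw2 _ (hom_laE X Y)) ?compA.
rewrite (rw2 _ (ascL _ _ _)) ?compA (rw2 _ (ascM _ _ _)) ?compA fuL fuL hom_raE.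
by rewrite !whL ?compA pentagon.
Qed.

Definition hom_bim X Y : bimodule A :=
  Bimodule (hom_laA X Y) (hom_la1 X Y) (hom_raA X Y) (hom_ra1 X Y) (hom_lraA X Y).

Context (ez : equalizers C).

Definition homA_l X Y : hom (ihom cl X Y) (ihom cl (X ⊗ A) Y) :=
  icur cl (iev cl X Y ∘ (ihom cl X Y ◁ ra X)).

Definition homA_r X Y : hom (ihom cl X Y) (ihom cl (X ⊗ A) Y) :=
  icur cl (ra Y ∘ (iev cl X Y ▷ A) ∘ asci (ihom cl X Y) X A).

Definition homA_car X Y : C := eqz ez (homA_l X Y) (homA_r X Y).

Definition homA_in X Y : hom (homA_car X Y) (ihom cl X Y) :=
  eqz_in ez (homA_l X Y) (homA_r X Y).

Lemma homA_in_mono X Y (W : C) (k k' : hom W (homA_car X Y)) :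
  homA_in X Y ∘ k = homA_in X Y ∘ k' -> k = k'.
Proof. exact: eqz_uniq. Qed.

Lemma homA_factorP X Y (W : C) (k : hom W (ihom cl X Y)) (e : hom (W ⊗ X) Y) :
  iev cl X Y ∘ (k ▷ X) = e ->
  (homA_l X Y ∘ k = homA_r X Y ∘ k <->
   e ∘ (W ◁ ra X) = ra Y ∘ (e ▷ A) ∘ asci W X A).
Proof.
move=> <-.
have hl : iev cl (X ⊗ A) Y ∘ ((homA_l X Y ∘ k) ▷ (X ⊗ A))
    = (iev cl X Y ∘ (k ▷ X)) ∘ (W ◁ ra X).
  by rewrite whR (rw2 _ (icurE _ _)) ?compA xch.
have hr : iev cl (X ⊗ A) Y ∘ ((homA_r X Y ∘ k) ▷ (X ⊗ A))
    = ra Y ∘ ((iev cl X Y ∘ (k ▷ X)) ▷ A) ∘ asci W X A.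
  by rewrite whR (rw2 _ (icurE _ _)) ?compA asciR whR ?compA.
split=> [E | E]; first by rewrite -hl -hr E.
by apply: (icur_uniq (c := cl)); rewrite hl hr.
Qed.

Definition homA_ev X Y : hom (homA_car X Y ⊗ X) Y :=
  iev cl X Y ∘ (homA_in X Y ▷ X).

Lemma homA_ev_bal X Y :
  homA_ev X Y ∘ (homA_car X Y ◁ ra X)
  = ra Y ∘ (homA_ev X Y ▷ A) ∘ asci (homA_car X Y) X A.
Proof.
apply/(homA_factorP (k := homA_in X Y) (eq_refl _)).
exact: eqz_eq.
Qed.

Lemma homA_la_adj X Y :
  iev cl X Y ∘ ((hom_la X Y ∘ (A ◁ homA_in X Y)) ▷ X)
  = la Y ∘ (A ◁ homA_ev X Y) ∘ asc A (homA_car X Y) X.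
Proof.
rewrite whR (rw2 _ (hom_laE X Y)) ?compA ascM.
by rewrite /homA_ev whL ?compA.
Qed.

Lemma homA_ra_adj X Y :
  iev cl X Y ∘ ((hom_ra X Y ∘ (homA_in X Y ▷ A)) ▷ X)
  = homA_ev X Y ∘ (homA_car X Y ◁ la X) ∘ asc (homA_car X Y) A X.
Proof.
rewrite whR (rw2 _ (hom_raE X Y)) ?compA ascR.
by rewrite (rw2 _ (xch _ _)) ?compA /homA_ev ?compA.
Qed.

Lemma homA_la_proof X Y :
  homA_l X Y ∘ hom_la X Y ∘ (A ◁ homA_in X Y)
  = homA_r X Y ∘ hom_la X Y ∘ (A ◁ homA_in X Y).
Proof.
apply/(homA_factorP (homA_la_adj X Y)).
move: (homA_ev_bal X Y); move: (homA_ev X Y) => v hv.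
rewrite ?compA ascL fuL hv !whL !whR ?compA.
rewrite (rw2 _ (lraA Y)) ?compA (rw2 _ (ascM _ _ _)) ?compA.
by rewrite (rw2 _ (eq_sym (penta1 _ _ _ _))) ?compA asciK id_r.
Qed.

Lemma homA_ra_proof X Y :
  homA_l X Y ∘ hom_ra X Y ∘ (homA_in X Y ▷ A)
  = homA_r X Y ∘ hom_ra X Y ∘ (homA_in X Y ▷ A).
Proof.
apply/(homA_factorP (homA_ra_adj X Y)).
have e : la X ∘ (A ◁ ra X) = ra X ∘ (la X ▷ A) ∘ asci A X A.
  by rewrite (rw2 _ (lraA X)) ?compA asciK id_r.
move: (homA_ev_bal X Y); move: (homA_ev X Y) => v hv.
rewrite ?compA ascL fuL e !whL !whR ?compA (rw2 _ hv) ?compA.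
by rewrite (rw2 _ (asciM _ _ _)) ?compA penta4.
Qed.

Definition homA_la X Y : hom (A ⊗ homA_car X Y) (homA_car X Y) :=
  eqz_lift ez (homA_la_proof X Y).

Definition homA_ra X Y : hom (homA_car X Y ⊗ A) (homA_car X Y) :=
  eqz_lift ez (homA_ra_proof X Y).

Lemma homA_laE X Y :
  homA_in X Y ∘ homA_la X Y = hom_la X Y ∘ (A ◁ homA_in X Y).
Proof. exact: eqz_liftE. Qed.

Lemma homA_raE X Y :
  homA_in X Y ∘ homA_ra X Y = hom_ra X Y ∘ (homA_in X Y ▷ A).
Proof. exact: eqz_liftE. Qed.

Lemma homA_laA X Y :
  homA_la X Y ∘ (mul A ▷ homA_car X Y)
  = homA_la X Y ∘ (A ◁ homA_la X Y) ∘ asc A A (homA_car X Y).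
Proof.
apply: homA_in_mono; rewrite !(rw2 _ (homA_laE X Y)) ?compA fuL homA_laE.
by rewrite xch (rw2 _ (hom_laA X Y)) ?compA ascL whL ?compA.
Qed.

Lemma homA_la1 X Y : homA_la X Y ∘ (one A ▷ homA_car X Y) = lun (homA_car X Y).
Proof.
apply: homA_in_mono; rewrite (rw2 _ (homA_laE X Y)) ?compA.
by rewrite xch (rw2 _ (hom_la1 X Y)) ?compA lun_nat.
Qed.

Lemma homA_raA X Y :
  homA_ra X Y ∘ (homA_ra X Y ▷ A)
  = homA_ra X Y ∘ (homA_car X Y ◁ mul A) ∘ asc (homA_car X Y) A A.
Proof.
apply: homA_in_mono; rewrite !(rw2 _ (homA_raE X Y)) ?compA -whR homA_raE.
rewrite (rw2 _ (eq_sym (xch _ _))) ?compA -ascR whR.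
by rewrite (rw2 _ (hom_raA X Y)) ?compA.
Qed.

Lemma homA_ra1 X Y : homA_ra X Y ∘ (homA_car X Y ◁ one A) = run (homA_car X Y).
Proof.
apply: homA_in_mono; rewrite (rw2 _ (homA_raE X Y)) ?compA.
by rewrite -xch (rw2 _ (hom_ra1 X Y)) ?compA run_nat.
Qed.

Lemma homA_lraA X Y :
  homA_ra X Y ∘ (homA_la X Y ▷ A)
  = homA_la X Y ∘ (A ◁ homA_ra X Y) ∘ asc A (homA_car X Y) A.
Proof.
apply: homA_in_mono; rewrite (rw2 _ (homA_raE X Y)) ?compA (rw2 _ (homA_laE X Y)) ?compA.
rewrite -whR fuL homA_raE homA_laE whR whL ?compA (rw2 _ (hom_lraA X Y)) ?compA.
by rewrite ascM.
Qed.

Definition homA X Y : bimodule A :=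
  Bimodule (homA_laA X Y) (homA_la1 X Y) (homA_raA X Y) (homA_ra1 X Y)
    (homA_lraA X Y).

(* Functoriality of [homA - Y]: precomposition, restricted to the equalizers. *)
Section Precomposition.
Context (X X' Y : bimodule A) (f : bimodule_hom X X').

Definition hom_pre : hom (ihom cl X' Y) (ihom cl X Y) :=
  icur cl (iev cl X' Y ∘ (ihom cl X' Y ◁ f)).

Lemma hom_preE :
  iev cl X Y ∘ (hom_pre ▷ X) = iev cl X' Y ∘ (ihom cl X' Y ◁ f).
Proof. exact: icurE. Qed.

Lemma hom_pre_adj :
  iev cl X Y ∘ ((hom_pre ∘ homA_in X' Y) ▷ X)
  = homA_ev X' Y ∘ (homA_car X' Y ◁ f).
Proof. by rewrite whR (rw2 _ hom_preE) ?compA xch /homA_ev ?compA. Qed.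

Lemma homA_pre_proof :
  homA_l X Y ∘ hom_pre ∘ homA_in X' Y = homA_r X Y ∘ hom_pre ∘ homA_in X' Y.
Proof.
apply/(homA_factorP hom_pre_adj).
move: (homA_ev_bal X' Y); move: (homA_ev X' Y) => v hv.
rewrite ?compA -whL bmor_r whL (rw2 _ hv) ?compA asciM.
by rewrite whR ?compA.
Qed.

Definition homA_pre_mor : hom (homA_car X' Y) (homA_car X Y) :=
  eqz_lift ez homA_pre_proof.

Lemma homA_preE : homA_in X Y ∘ homA_pre_mor = hom_pre ∘ homA_in X' Y.
Proof. exact: eqz_liftE. Qed.

Lemma hom_pre_l : hom_pre ∘ hom_la X' Y = hom_la X Y ∘ (A ◁ hom_pre).
Proof.
apply: (icur_uniq (c := cl)); rewrite !whR (rw2 _ hom_preE) (rw2 _ (hom_laE _ _)) ?compA.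
rewrite xch (rw2 _ (hom_laE _ _)) ?compA ascM ascL fuL fuL hom_preE.
by rewrite ?compA.
Qed.

Lemma hom_pre_r : hom_pre ∘ hom_ra X' Y = hom_ra X Y ∘ (hom_pre ▷ A).
Proof.
apply: (icur_uniq (c := cl)); rewrite !whR (rw2 _ hom_preE) (rw2 _ (hom_raE X Y)) ?compA.
rewrite xch (rw2 _ (hom_raE _ _)) ?compA ascR ascL fuL -bmor_l whL ?compA.
by rewrite (rw2 _ (xch _ _)) ?compA (rw2 _ hom_preE) ?compA.
Qed.

Lemma homA_pre_l :
  homA_pre_mor ∘ la (homA X' Y) = la (homA X Y) ∘ (A ◁ homA_pre_mor).
Proof.
apply: homA_in_mono; rewrite /= (rw2 _ homA_preE) (rw2 _ (homA_laE _ _)) ?compA.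
by rewrite homA_laE (rw2 _ hom_pre_l) ?compA -!whL homA_preE.
Qed.

Lemma homA_pre_r :
  homA_pre_mor ∘ ra (homA X' Y) = ra (homA X Y) ∘ (homA_pre_mor ▷ A).
Proof.
apply: homA_in_mono; rewrite /= (rw2 _ homA_preE) (rw2 _ (homA_raE _ _)) ?compA.
by rewrite homA_raE (rw2 _ hom_pre_r) ?compA -!whR homA_preE.
Qed.

Definition homA_pre : bimodule_hom (homA X' Y) (homA X Y) :=
  @BimoduleHom C A (homA X' Y) (homA X Y) homA_pre_mor homA_pre_l homA_pre_r.

End Precomposition.

End InternalHom.

Section Dagger.
Context (C : monoidal) (cl : closed C) (ez : equalizers C) (A : algebra C).

Definition dagger (M : bimodule A) : bimodule A := homA cl ez M (regular A).

Definition dagger_hom (M N : bimodule A) (f : bimodule_hom M N) :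
    bimodule_hom (dagger N) (dagger M) :=
  homA_pre cl ez (regular A) f.

Context (c : braiding C) (hA : commutative c A).

Definition rdagger (M : rmodule A) : rmodule A :=
  to_rmod (dagger (sbim (commutative_lcc hA) M)).

Definition rdagger_hom (M N : rmodule A) (f : rmodule_hom M N) :
    rmodule_hom (rdagger N) (rdagger M) :=
  to_rmod_hom (dagger_hom (sbim_hom (commutative_lcc hA) f)).

End Dagger.

(* Main.v *)
From Corelib Require Import ssreflect.
From Stdlib Require Import ProofIrrelevance IndefiniteDescription.
Require Import Defs.

(* [homA X Y] is the internal hom of bimodules, so a bimodule [M] with a left
   dual has [dagger M] as its left dual, and naturality of σ along the evaluation
   shows that [dagger M] satisfies [la = ra ∘ σ] when [M] does.
     For a right dual [N] of such an [M], let z = Σ nᵢ ⊗ mᵢ : 𝟙 -> N ⊗_A M be the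
   coevaluation, so that n = Σ nᵢ mᵢ(n).  Write a ⊗ n ↦ n^σ ⊗ a^σ for σ.  Since
   a^σ mᵢ = mᵢ^σ a^σσ, applying the σ-twisted left action to n = Σ nᵢ mᵢ(n) gives
   Σ nᵢ^σ (mᵢ^σ a^σσ)(n); naturality of σ along z turns this into Σ nᵢ (mᵢ a)(n),
   which is a n because a z = z a.
     A module over a commutative algebra in a braided category is local if and
   only if its bimodule also lies in C_A^σ' for the reverse braiding σ', so the
   local case is an instance of the previous one. *)

Set Implicit Arguments.
Unset Strict Implicit.
Unset Printing Implicit Defensive.

(** * Transposition along a dual pair and uniqueness of left duals *)

Section Duality.
Context (V : monoidal).
Implicit Types X Y H M N : V.

(** Naturality of [lun] along [lun 𝟙] gives [𝟙 ◁ lun 𝟙 = lun (𝟙 ⊗ 𝟙)]; the triangle axiom does the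
    rest. *)
Lemma lun_run_unit : lun (𝟙 : V) = run 𝟙.
Proof.
apply: whR_inj; rewrite -triangle -lun_asc; congr (_ ∘ _).
rewrite -[LHS]id_l -[RHS]id_l -lunK !compA; congr (_ ∘ _).
by rewrite lun_nat.
Qed.

Lemma asc_runi X Y : asc X 𝟙 Y ∘ (runi X ▷ Y) = X ◁ luni Y.
Proof.
rewrite -[LHS]id_l -(whL_iso X (lunK Y)) compA (rw2 _ (triangle _ _)).
by rewrite (whR_iso _ (runiK _)) id_r.
Qed.

Lemma asci_runi X Y : asci X Y 𝟙 ∘ (X ◁ runi Y) = runi (X ⊗ Y).
Proof.
rewrite -[LHS]id_l -(runK (X ⊗ Y)) compA (rw2 _ (run_asci _ _)).
by rewrite (whL_iso _ (runiK _)) id_r.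
Qed.

(** The adjunct of [g] when [- ⊗ X] is left adjoint to [- ⊗ Y]. The second zigzag of [is_dual] is
    [transpose coev ev = idm Y]. *)
Definition transpose X Y H (coev : hom 𝟙 (X ⊗ Y)) (g : hom (H ⊗ X) 𝟙) : hom H Y :=
  lun Y ∘ (g ▷ Y) ∘ asci H X Y ∘ (H ◁ coev) ∘ runi H.

Section Dual.
Context (X Y : V) (ev : hom (Y ⊗ X) 𝟙) (coev : hom 𝟙 (X ⊗ Y)) (d : is_dual ev coev).

(** Naturality brings [ev] and [coev] together around the last factor [X], where the first zigzag,
    in the form [e], cancels them. *)
Lemma transposeE H (g : hom (H ⊗ X) 𝟙) : ev ∘ (transpose coev g ▷ X) = g.
Proof.
case: d => d1 _.
have e : (X ◁ ev) ∘ asc X Y X ∘ (coev ▷ X) ∘ luni X = runi X.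
  by rewrite -[LHS]id_l -(runK X) compA d1 id_r.
rewrite /transpose !whR -lun_asc ?compA (rw2 _ (eq_sym (lun_nat ev))) ?compA.
rewrite (rw2 _ (ascR _ _ _)) ?compA (rw2 _ (xch _ _)) ?compA (rw2 _ (penta2 _ _ _ _)) ?compA.
rewrite (rw2 _ (ascM _ _ _)) ?compA asc_runi (rw2 _ (eq_sym (asciL _ _ _))) ?compA.
rewrite -!whL e asci_runi -runi_nat lun_run_unit (rw2 _ (runiK _)).
exact: id_l.
Qed.

Lemma transpose_nat H H' (k : hom H' H) (g : hom (H ⊗ X) 𝟙) :
  transpose coev (g ∘ (k ▷ X)) = transpose coev g ∘ k.
Proof.
rewrite /transpose !compA runi_nat (rw2 _ (xch _ _)) ?compA.
by rewrite (rw2 _ (asciR _ _ _)) whR ?compA.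
Qed.

Lemma transpose_ev : transpose coev ev = idm Y.
Proof. exact: (proj2 d). Qed.

Lemma ev_uniq H (k k' : hom H Y) : ev ∘ (k ▷ X) = ev ∘ (k' ▷ X) -> k = k'.
Proof.
move=> E; rewrite -(id_l k) -(id_l k') -transpose_ev.
by rewrite -!transpose_nat E.
Qed.

(** Both morphisms are the transpose of [evN ∘ (N' ◁ f)], so dual morphisms are recognised from
    evaluations alone. *)
Lemma dual_mor_uniq N N' (evN : hom (N' ⊗ N) 𝟙) (f : hom X N) (k : hom N' Y) :
  ev ∘ (k ▷ X) = evN ∘ (N' ◁ f) -> k = dual_mor coev evN f.
Proof.
move=> E; rewrite -[LHS]id_l -transpose_ev -transpose_nat E /transpose /dual_mor.
by rewrite whR ?compA (rw2 _ (asciM _ _ _)) ?compA.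
Qed.

(** [H] and [Y] represent the same functor [W ↦ hom (W ⊗ X) 𝟙], so [coev] is carried along the
    comparison [k : Y -> H]. *)
Lemma universal_is_dual H (evH : hom (H ⊗ X) 𝟙) :
  (forall W (g : hom (W ⊗ X) 𝟙), exists k : hom W H, evH ∘ (k ▷ X) = g) ->
  (forall W (k k' : hom W H), evH ∘ (k ▷ X) = evH ∘ (k' ▷ X) -> k = k') ->
  exists coevH : hom 𝟙 (X ⊗ H), is_dual evH coevH.
Proof.
move=> ex un; case: (ex _ ev) => k hk; exists ((X ◁ k) ∘ coev); split.
  rewrite whR ?compA (rw2 _ (ascM _ _ _)) ?compA fuL hk.
  exact: (proj1 d).
have -> : lun H ∘ (evH ▷ H) ∘ asci H X H ∘ (H ◁ ((X ◁ k) ∘ coev)) ∘ runi H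
    = k ∘ transpose coev evH.
  rewrite /transpose whL ?compA (rw2 _ (asciL _ _ _)) ?compA.
  by rewrite (rw2 _ (eq_sym (xch _ _))) ?compA (rw2 _ (lun_nat _)) ?compA.
by apply: un; rewrite whR (rw2 _ hk) transposeE tensh_id id_r.
Qed.

Lemma is_dual_iso Y' (i : hom Y' Y) (j : hom Y Y') :
  j ∘ i = idm _ -> i ∘ j = idm _ ->
  is_dual (ev ∘ (i ▷ X)) ((X ◁ j) ∘ coev).
Proof.
case: d => d1 d2 ji ij; split.
  rewrite whR ?compA (rw2 _ (ascM _ _ _)) ?compA fuL compA -(whR _ i j) ij tensh_id id_r.
  exact: d1.
have -> : lun Y' ∘ ((ev ∘ (i ▷ X)) ▷ Y') ∘ asci Y' X Y' ∘ (Y' ◁ ((X ◁ j) ∘ coev)) ∘ runi Y'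
    = j ∘ transpose coev (ev ∘ (i ▷ X)).
  rewrite /transpose whL ?compA (rw2 _ (asciL _ _ _)) ?compA.
  by rewrite (rw2 _ (eq_sym (xch _ _))) ?compA (rw2 _ (lun_nat _)) ?compA.
by rewrite transpose_nat transpose_ev id_l.
Qed.

End Dual.
End Duality.

(** * Duals under a transported monoidal structure *)

Section TransportDual.
Context (V : monoidal) (D : category) (F : D -> V).
Context (Fh : forall X Y : D, hom X Y -> hom (F X) (F Y)).
Context (Fi : forall X Y : D, hom (F X) (F Y) -> hom X Y).
Context (Fh_id : forall X : D, Fh (idm X) = idm (F X)).
Context (Fh_comp : forall (X Y Z : D) (g : hom Y Z) (f : hom X Y),
  Fh (g ∘ f) = Fh g ∘ Fh f).
Context (FhK : forall (X Y : D) (f : hom X Y), Fi (Fh f) = f).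
Context (FiK : forall (X Y : D) (f : hom (F X) (F Y)), Fh (Fi f) = f).
Context (u : D) (t : D -> D -> D).
Context (e : hom 𝟙 (F u)) (ei : hom (F u) 𝟙).
Context (eK : ei ∘ e = idm _) (eiK : e ∘ ei = idm _).
Context (m : forall X Y : D, hom (F X ⊗ F Y) (F (t X Y))).
Context (mi : forall X Y : D, hom (F (t X Y)) (F X ⊗ F Y)).
Context (mK : forall X Y : D, mi X Y ∘ m X Y = idm _).
Context (miK : forall X Y : D, m X Y ∘ mi X Y = idm _).

Let T := transport Fh_id Fh_comp FhK FiK eK eiK mK miK.

(** Faithfulness of [F] moves each zigzag to [V], where [e] and [m] cancel against their
    inverses. *)
Lemma transport_dual (X Y : T) (ev : hom (F Y ⊗ F X) 𝟙) (coev : hom 𝟙 (F X ⊗ F Y)) :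
  is_dual ev coev ->
  @is_dual T X Y (Fi (e ∘ ev ∘ mi Y X)) (Fi (m X Y ∘ coev ∘ ei)).
Proof.
case=> d1 d2; split; apply: (Fh_inj FhK); rewrite /= !Fh_comp !FiK !Fh_id ?compA.
  rewrite !(rw2 _ (mK _ _)) ?id_l !whL !whR ?compA.
  rewrite (rw2 _ (whL_iso _ eK)) id_l (rw2 _ (whL_iso _ (mK _ _))) id_l.
  rewrite (rw2 _ (whR_iso _ (mK _ _))) id_l (rw2 _ (whR_iso _ eK)) id_l.
  exact: d1.
rewrite !(rw2 _ (mK _ _)) ?id_l !whL !whR ?compA.
rewrite (rw2 _ (whR_iso _ eK)) id_l (rw2 _ (whR_iso _ (mK _ _))) id_l.
rewrite (rw2 _ (whL_iso _ (mK _ _))) id_l (rw2 _ (whL_iso _ eK)) id_l.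
exact: d2.
Qed.

Lemma transport_pairing (M N M' N' : T) (evM : hom (F M' ⊗ F M) 𝟙)
    (evN : hom (F N' ⊗ F N) 𝟙) (f : hom M N) (k : hom N' M') :
  evM ∘ (Fh k ▷ F M) = evN ∘ (F N' ◁ Fh f) ->
  (Fi (e ∘ evM ∘ mi M' M) : @hom T (M' ⊗ M) 𝟙) ∘ (k ▷ M)
  = (Fi (e ∘ evN ∘ mi N' N) : @hom T (N' ⊗ N) 𝟙) ∘ (N' ◁ f).
Proof.
move=> E; apply: (Fh_inj FhK); rewrite /= !Fh_comp !FiK !Fh_id ?compA.
by rewrite !(rw2 _ (mK _ _)) ?id_l (rw2 _ E) ?compA.
Qed.
End TransportDual.

(** * Internal hom of bimodules as adjoint to tensoring over A *)

Section BimoduleInternalHom.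
Context (C : monoidal) (cl : closed C) (ez : equalizers C) (cq : coequalizers C).
Context (A : algebra C).
Implicit Types W X Y : bimodule A.

Lemma homA_ev_la X Y :
  homA_ev cl ez X Y ∘ (homA_la cl ez X Y ▷ X)
  = la Y ∘ (A ◁ homA_ev cl ez X Y) ∘ asc A (homA_car cl ez X Y) X.
Proof. by rewrite -homA_la_adj /homA_ev compA -whR homA_laE. Qed.

(** The right action on [homA] is precomposition with [la X]; so evaluation is balanced and descends
    to the tensor product over [A]. *)
Lemma homA_ev_ra X Y :
  homA_ev cl ez X Y ∘ (homA_ra cl ez X Y ▷ X)
  = homA_ev cl ez X Y ∘ (homA_car cl ez X Y ◁ la X) ∘ asc (homA_car cl ez X Y) A X.
Proof. by rewrite -homA_ra_adj {1}/homA_ev compA -whR homA_raE. Qed.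

Lemma homA_ev_inj X Y (W : C) (k k' : hom W (homA_car cl ez X Y)) :
  homA_ev cl ez X Y ∘ (k ▷ X) = homA_ev cl ez X Y ∘ (k' ▷ X) -> k = k'.
Proof.
move=> E; apply: homA_in_mono; apply: (icur_uniq (c := cl)).
by move: E; rewrite /homA_ev !whR !compA.
Qed.

Definition bev_mor X Y : hom (btens_car cq (homA cl ez X Y) X) Y :=
  coeq_desc cq (homA_ev_ra X Y).

Lemma bev_morE X Y : bev_mor X Y ∘ bpr cq (homA cl ez X Y) X = homA_ev cl ez X Y.
Proof. exact: coeq_descE. Qed.

Lemma bev_mor_l X Y :
  bev_mor X Y ∘ la (btens cl cq (homA cl ez X Y) X) = la Y ∘ (A ◁ bev_mor X Y).
Proof.
apply: (bpr_epiL cl (Z := A)); rewrite /= ?compA -whL bev_morE.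
rewrite (btens_laE cl cq (homA cl ez X Y) X) /=.
by rewrite (rw2 _ (bev_morE _ _)) (rw2 _ (homA_ev_la _ _)) ?compA asciK id_r.
Qed.

(** Right linearity of the evaluation is the equalizer condition defining [homA]. *)
Lemma bev_mor_r X Y :
  bev_mor X Y ∘ ra (btens cl cq (homA cl ez X Y) X) = ra Y ∘ (bev_mor X Y ▷ A).
Proof.
apply: (bpr_epiR cl (Z := A)); rewrite /= ?compA -whR bev_morE.
rewrite (btens_raE cl cq (homA cl ez X Y) X) /=.
by rewrite (rw2 _ (bev_morE _ _)) (rw2 _ (homA_ev_bal _ _ _ _)) ?compA ascK id_r.
Qed.

Definition bev X Y :
    @hom (bimod A cl cq) (@tens (bimod A cl cq) (homA cl ez X Y) X) Y :=
  @BimoduleHom C A (btens cl cq (homA cl ez X Y) X) Y (bev_mor X Y)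
    (bev_mor_l X Y) (bev_mor_r X Y).

Lemma bev_btens_mor W X X' Y (k : bimodule_hom W (homA cl ez X Y))
    (f : bimodule_hom X' X) :
  bev_mor X Y ∘ btens_mor cq k f ∘ bpr cq W X' = homA_ev cl ez X Y ∘ (k ⊠ f).
Proof. by rewrite btens_morE (rw2 _ (bev_morE _ _)). Qed.

Lemma bev_uniq (W X Y : bimod A cl cq) (k k' : hom W (homA cl ez X Y)) :
  bev X Y ∘ (k ▷ X)
  = bev X Y ∘ (k' ▷ X) -> k = k'.
Proof.
move=> E.
have := f_equal (fun h : bimodule_hom (btens cl cq W X) Y => bmor h ∘ bpr cq W X) E.
rewrite /= !compA (bev_btens_mor k (bim_id X)) (bev_btens_mor k' (bim_id X)) => E'.
by apply: bmor_inj; apply: homA_ev_inj.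
Qed.

Section Currying.
Context (W X Y : bimodule A) (g : bimodule_hom (btens cl cq W X) Y).

Let gE : hom (W ⊗ X) Y := g ∘ bpr cq W X.

(** Currying lands in the equalizer because [g] is right linear. *)
Lemma bcur_proof : homA_l cl X Y ∘ icur cl gE = homA_r cl X Y ∘ icur cl gE.
Proof.
apply/(homA_factorP (icurE cl gE)).
rewrite /gE !whR ?compA (rw2 _ (eq_sym (bmor_r g))) ?compA /=.
by rewrite (rw2 _ (btens_raE _ _ _ _)) ?compA asciK id_r.
Qed.

Definition bcur_mor : hom W (homA_car cl ez X Y) := eqz_lift ez bcur_proof.

Lemma bcur_morE : homA_ev cl ez X Y ∘ (bcur_mor ▷ X) = gE.
Proof. by rewrite /homA_ev compA -whR eqz_liftE icurE. Qed.

Lemma bcur_mor_l : bcur_mor ∘ la W = la (homA cl ez X Y) ∘ (A ◁ bcur_mor).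
Proof.
apply: homA_ev_inj; rewrite /= !whR (rw2 _ bcur_morE) (rw2 _ (homA_ev_la _ _)) ?compA.
rewrite ascM fuL bcur_morE /gE whL ?compA (rw2 _ (eq_sym (bmor_l g))) ?compA /=.
by rewrite (rw2 _ (btens_laE _ _ _ _)) ?compA ascK id_r.
Qed.

Lemma bcur_mor_r : bcur_mor ∘ ra W = ra (homA cl ez X Y) ∘ (bcur_mor ▷ A).
Proof.
apply: homA_ev_inj; move: (homA_ev_ra X Y) bcur_morE.
move: (homA_ev cl ez X Y) => v hr hv; rewrite /= !whR (rw2 _ hv) (rw2 _ hr) ?compA.
by rewrite ascR (rw2 _ (xch _ _)) ?compA (rw2 _ hv) /gE ?compA bpr_bal.
Qed.

Definition bcur : bimodule_hom W (homA cl ez X Y) :=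
  @BimoduleHom C A W (homA cl ez X Y) bcur_mor bcur_mor_l bcur_mor_r.

Lemma bcurE :
  bev X Y
    ∘ ((bcur : @hom (bimod A cl cq) _ _) ▷ (X : bimod A cl cq)) = g.
Proof.
apply: bmor_inj; apply: bpr_epi; rewrite /= compA (bev_btens_mor bcur (bim_id X)).
exact: bcur_morE.
Qed.

End Currying.

(** By [bcur] and [bev_uniq], [dagger M] represents the functor that any left dual of [M]
    represents. *)
Lemma dagger_is_dual (M : bimod A cl cq) :
  has_left_dual M ->
  exists coev : hom 𝟙 (M ⊗ (dagger cl ez M : bimod A cl cq)),
    @is_dual (bimod A cl cq) M (dagger cl ez M) (bev M (regular A)) coev.
Proof.
case=> [Y [ev [coev d]]]; apply: (universal_is_dual d) => [W g | W k k'].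
  by exists (bcur g); exact: bcurE.
exact: bev_uniq.
Qed.

(** Through [dual_mor_uniq], this identifies [dagger_hom] with the dual morphism. *)
Lemma bev_dagger_hom (M N : bimod A cl cq) (f : hom M N) :
  bev M (regular A)
    ∘ ((dagger_hom cl ez f : @hom (bimod A cl cq) _ _) ▷ M)
  = bev N (regular A)
    ∘ ((dagger cl ez N : bimod A cl cq) ◁ f).
Proof.
apply: bmor_inj; apply: bpr_epi; rewrite /= !compA.
rewrite (bev_btens_mor (dagger_hom cl ez f) (bim_id M)) (bev_btens_mor (bim_id _) f) /=.
by rewrite -hom_pre_adj -homA_preE /homA_ev whR compA.
Qed.

End BimoduleInternalHom.

(** * Closure of C_A^σ under internal homs and right duals *)

Section SigmaDuals.
Context (C : monoidal) (cl : closed C) (ez : equalizers C) (cq : coequalizers C).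
Context (A : algebra C) (s : lax_half_braiding A).

(** After evaluation, naturality of σ along [v] on one side and right linearity of [v] on the other
    leave an instance of [hb_tens]. *)
Lemma homA_in_sigma (X Y : bimodule A) :
  in_sigma s X -> in_sigma s Y -> in_sigma s (homA cl ez X Y).
Proof.
rewrite /in_sigma => hX hY; apply: (homA_ev_inj (X := X) (Y := Y)).
rewrite homA_ev_la whR (rw2 _ (homA_ev_ra _ _ _ _)).
move: (homA_ev_bal cl ez X Y); move: (homA_ev cl ez X Y) => v hv.
rewrite ?compA hX hY whL ?compA (rw2 _ hv) ?compA (rw2 _ (hb_nat _ _)) ?compA.
by rewrite hb_tens ?compA ascK id_r.
Qed.

Context (hs : lax_central_commutative s).

(** σ moves a scalar past [X], then past [Y]; the second passage followed by [ra Y] is [la Y], which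
    balancing turns into [ra X]. *)
Lemma btens_ra_hb (X Y : bimodule A) : in_sigma s Y ->
  btens_ra cl cq X Y ∘ hb s _ ∘ (A ◁ bpr cq X Y)
  = bpr cq X Y ∘ ((ra X ∘ hb s X) ▷ Y) ∘ asci A X Y.
Proof.
rewrite /in_sigma => hY.
rewrite hb_nat (rw2 _ (btens_raE _ _ _ _)) ?compA hb_tens whR ?compA.
rewrite (rw2 _ (asciK _ _ _)) ?compA id_l (rw2 _ (bpr_bal _ _ _)) ?compA.
by rewrite hY whL ?compA.
Qed.

Lemma in_sigma_right_dual (M N : bimodule A)
    (ev : bimodule_hom (btens cl cq M N) (regular A))
    (coev : bimodule_hom (regular A) (btens cl cq N M)) :
  @is_dual (bimod A cl cq) N M ev coev -> in_sigma s M -> in_sigma s N.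
Proof.
case=> d _ hM.
pose z : hom 𝟙 (btens cl cq N M) := bmor coev ∘ one A.
(* In elements, [L] sends (n ⊗ m) ⊗ n' to n m(n'), as [LE] records; [Lz] is the zigzag n = Σ nᵢ
   mᵢ(n). *)
pose L : hom (btens cl cq N M ⊗ N) N :=
  brun_mor cl cq N ∘ btens_mor cq (bim_id N) ev ∘ basc_mor cl cq N M N
    ∘ bpr cq (btens cl cq N M) N.
have LE : L ∘ (bpr cq N M ▷ N) = ra N ∘ (N ◁ (ev ∘ bpr cq M N)) ∘ asc N M N.
  rewrite /L ?compA basc_morE (rw2 _ (btens_morE _ _ _)) ?compA fuL.
  by rewrite (rw2 _ (brun_morE _ _ _)).
have Lz : L ∘ (z ▷ N) ∘ luni N = idm _.
  have := f_equal (fun h : bimodule_hom N N => bmor h) d.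
  rewrite /= /bluni_mor (rw2 _ (btens_morE _ _ _)) ?compA /L /z whR ?compA.
  by [].
move: L LE Lz => L LE Lz.
(* Applied to the two left actions of [N]: its own and the σ-twisted one. *)
have key (l : hom (A ⊗ N) N) (r : hom (A ⊗ btens cl cq N M) (btens cl cq N M)) :
    ra N ∘ (l ▷ A) = l ∘ (A ◁ ra N) ∘ asc A N A ->
    r ∘ (A ◁ bpr cq N M) = bpr cq N M ∘ (l ▷ M) ∘ asci A N M ->
    r ∘ (A ◁ z) = bmor coev ∘ run A ->
    l = L ∘ ((bmor coev ∘ run A) ▷ N) ∘ asci A 𝟙 N ∘ (A ◁ luni N).
  move=> hl hr hz.
  (* Since [l] commutes with right multiplication, it acts on n m(n') through n, and [r] is that
     action on n ⊗ m. *)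
  have hL : l ∘ (A ◁ L) = L ∘ (r ▷ N) ∘ asci A _ N.
    apply: (epiL cl (@bpr_epiR C A cl cq N M N)).
    rewrite ?compA -whL LE asciM fuR hr !whR ?compA (rw2 _ LE) ?compA.
    rewrite (rw2 _ (ascR _ _ _)) ?compA penta3 (rw2 _ (xch _ _)) ?compA.
    rewrite (rw2 _ hl) ?compA (rw2 _ (ascL _ _ _)) ?compA.
    by rewrite (rw2 _ (asciK _ _ _)) id_l !whL ?compA.
  (* Expanding n as Σ nᵢ mᵢ(n) leaves [r] acting on [z] alone. *)
  rewrite -[LHS]id_r -tensh_id -[X in _ ⊠ X]Lz !whL (rw2 _ hL) ?compA.
  by rewrite (rw2 _ (asciM _ _ _)) ?compA fuR hz.
have hz : btens_la cl cq N M ∘ (A ◁ z) = bmor coev ∘ run A.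
  by rewrite /z whL (rw2 _ (eq_sym (bmor_l coev))) /= ?compA mul1r.
(* The formula in [key] contains neither [l] nor [r], so the two actions agree once both meet its
   hypotheses. *)
rewrite /in_sigma (key (la N) _ (lraA N) (btens_laE _ _ _ _) hz).
symmetry; apply: (key _ (btens_ra cl cq N M ∘ hb s _)).
- exact: (sbim_lraA hs (to_rmod N)).
- by rewrite compA; exact: btens_ra_hb.
(* Naturality of σ along [z] turns the twisted action on [z] into z a, which equals coev(a) by right
   linearity. *)
- rewrite compA hb_nat hb_unit /z whR ?compA (rw2 _ (eq_sym (bmor_r coev))) /= ?compA.
  by rewrite (rw2 _ (mul1l A)) (rw2 _ (luniK A)) id_l.
Qed.

End SigmaDuals.

(** * Left duality functors from evaluations *)

Section LeftDualityFunctor.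
Context (V : monoidal) (D : V -> V).
Context (Dmor : forall M N : V, hom M N -> hom (D N) (D M)).

Lemma left_duality_functorI (ev : forall M : V, hom (D M ⊗ M) 𝟙) :
  (forall M, exists coev, is_dual (ev M) coev) ->
  (forall M N (f : hom M N), ev M ∘ (Dmor f ▷ M) = ev N ∘ (D N ◁ f)) ->
  is_left_duality_functor Dmor.
Proof.
move=> d h.
(* A whole family of coevaluations is required, while [d] gives mere existence for each [M]; hence
   the choice. *)
exists ev, (fun M => proj1_sig (constructive_indefinite_description _ (d M))).
split=> [M | M N f]; first exact: proj2_sig.
by apply: (dual_mor_uniq (ev := ev M)); [exact: proj2_sig | exact: h].
Qed.

Lemma left_duality_has_left_dual :
  is_left_duality_functor Dmor -> forall M : V, has_left_dual M.
Proof. by case=> ev [coev [d _]] M; exists (D M), (ev M), (coev M). Qed.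

End LeftDualityFunctor.

(** * Rigidity of C_A^σ and of its model by right modules *)

Section SigmaRigid.
Context (C : monoidal) (cl : closed C) (ez : equalizers C) (cq : coequalizers C).
Context (A : algebra C) (s : lax_half_braiding A) (hs : lax_central_commutative s).

Lemma dagger_in_sigma (M : bimodule A) : in_sigma s M -> in_sigma s (dagger cl ez M).
Proof. by move=> hM; apply: homA_in_sigma => //; exact: in_sigma_regular. Qed.

Definition sigma_dagger (M : sigma_mod cl cq hs) : sigma_mod cl cq hs :=
  exist (in_sigma s) (dagger cl ez (proj1_sig M)) (dagger_in_sigma (proj2_sig M)).

Definition sigma_ev (M : sigma_mod cl cq hs) : hom (sigma_dagger M ⊗ M) 𝟙 :=
  bev cl ez cq (proj1_sig M) (regular A).

Lemma sigma_ev_dagger_hom (M N : sigma_mod cl cq hs) (f : hom M N) :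
  sigma_ev M ∘ ((dagger_hom cl ez f : hom (sigma_dagger N) (sigma_dagger M)) ▷ M)
  = sigma_ev N ∘ (sigma_dagger N ◁ f).
Proof. exact (@bev_dagger_hom C cl ez cq A (proj1_sig M) (proj1_sig N) f). Qed.

(** The left action is forced by [in_sigma] and the axioms are proof irrelevant, hence an equality
    and not only an isomorphism. *)
Lemma sbim_to_rmod (X : bimodule A) : in_sigma s X -> sbim hs (to_rmod X) = X.
Proof.
case: X => X l r h1 h2 h3 h4 h5; rewrite /in_sigma /= => e.
move: h1 h2 h5; rewrite e => h1 h2 h5.
rewrite /sbim /=; f_equal; exact: proof_irrelevance.
Qed.

Lemma sig_obj_to_rmod (X : sigma_mod cl cq hs) :
  sig_obj cl cq hs (to_rmod (proj1_sig X)) = X.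
Proof.
apply: eq_sig_hprop; first by move=> *; exact: proof_irrelevance.
exact: (sbim_to_rmod (proj2_sig X)).
Qed.

(** The evaluation produced by [transport_dual], corrected by [sig_isoi X] because [sig_obj] of the
    right module of [X] is not convertible to [X]. *)
Definition rmod_ev (M : rmodule A) (X : sigma_mod cl cq hs)
    (ev : hom (X ⊗ sig_obj cl cq hs M) 𝟙) :
    @hom (sigma_rmod cl cq hs)
      (@tens (sigma_rmod cl cq hs) (to_rmod (proj1_sig X)) M) 𝟙 :=
  of_sbim_hom (sig_iso 𝟙 ∘ (ev ∘ (sig_isoi X ▷ sig_obj cl cq hs M)) ∘
    sig_isoi (sig_obj cl cq hs (to_rmod (proj1_sig X)) ⊗ sig_obj cl cq hs M)).

Lemma rmod_ev_dual (M : rmodule A) (X : sigma_mod cl cq hs)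
    (ev : hom (X ⊗ sig_obj cl cq hs M) 𝟙) (coev : hom 𝟙 (sig_obj cl cq hs M ⊗ X)) :
  is_dual ev coev ->
  exists coev', @is_dual (sigma_rmod cl cq hs) M (to_rmod (proj1_sig X)) (rmod_ev ev) coev'.
Proof.
move=> d; eexists; apply: transport_dual.
by apply: (is_dual_iso d (j := sig_iso X)); apply: bmor_inj; exact: id_l.
Qed.

Definition sigma_rdagger (M : sigma_rmod cl cq hs) : sigma_rmod cl cq hs :=
  to_rmod (dagger cl ez (sbim hs M)).

Definition sigma_rdagger_hom (M N : sigma_rmod cl cq hs) (f : hom M N) :
    hom (sigma_rdagger N) (sigma_rdagger M) :=
  to_rmod_hom (dagger_hom cl ez (sbim_hom hs f)).

Definition sigma_rev (M : sigma_rmod cl cq hs) : hom (sigma_rdagger M ⊗ M) 𝟙 :=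
  rmod_ev (sigma_ev (sig_obj cl cq hs M)).

Lemma sigma_rev_dagger_hom (M N : sigma_rmod cl cq hs) (f : hom M N) :
  sigma_rev M ∘ (sigma_rdagger_hom f ▷ M) = sigma_rev N ∘ (sigma_rdagger N ◁ f).
Proof.
apply: transport_pairing.
have h := sigma_ev_dagger_hom (sbim_hom hs f : hom (sig_obj cl cq hs M) (sig_obj cl cq hs N)).
rewrite compA -whR; set SM := sig_obj cl cq hs M; set SN := sig_obj cl cq hs N.
(* [sig_isoi] is the identity on carriers, so its naturality reduces to the unit laws. *)
have -> : sig_isoi (sigma_dagger SM)
      ∘ (sbim_hom hs (sigma_rdagger_hom f) : hom (sig_obj cl cq hs _) (sig_obj cl cq hs _))
    = (dagger_hom cl ez (sbim_hom hs f) : hom (sigma_dagger SN) (sigma_dagger SM))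
      ∘ sig_isoi (sigma_dagger SN).
  by apply: bmor_inj; rewrite /= id_l id_r.
by rewrite whR (rw2 _ h) compA xch compA.
Qed.

Context (rig : rigid (bimod A cl cq)).

Lemma sigma_ev_dual (M : sigma_mod cl cq hs) : exists coev, is_dual (sigma_ev M) coev.
Proof. exact: (dagger_is_dual ez (proj1 (rig (proj1_sig M)))). Qed.

(** The last clause keeps the same [Y] for every other half-braiding; the local case applies it to
    the reverse braiding. *)
Lemma sigma_right_dual (M : sigma_mod cl cq hs) :
  exists (Y : sigma_mod cl cq hs) (ev : hom (M ⊗ Y) 𝟙) (coev : hom 𝟙 (Y ⊗ M)),
    is_dual ev coev /\
    forall s' : lax_half_braiding A, lax_central_commutative s' ->
      in_sigma s' (proj1_sig M) -> in_sigma s' (proj1_sig Y).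
Proof.
case: (proj2 (rig (proj1_sig M))) => [Y [ev [coev d]]].
exists (exist (in_sigma s) Y (in_sigma_right_dual hs d (proj2_sig M))), ev, coev.
split=> [| s' hs']; [exact: d | exact: (in_sigma_right_dual hs' d)].
Qed.

Lemma sigma_rev_dual (M : sigma_rmod cl cq hs) : exists coev, is_dual (sigma_rev M) coev.
Proof.
by case: (sigma_ev_dual (sig_obj cl cq hs M)) => coev; exact: rmod_ev_dual.
Qed.

Lemma sigma_rmod_right_dual (M : sigma_rmod cl cq hs) :
  exists (Y : sigma_rmod cl cq hs) (ev : hom (M ⊗ Y) 𝟙) (coev : hom 𝟙 (Y ⊗ M)),
    is_dual ev coev /\
    forall s' : lax_half_braiding A, lax_central_commutative s' ->
      in_sigma s' (sbim hs M) -> in_sigma s' (sbim hs Y).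
Proof.
case: (sigma_right_dual (sig_obj cl cq hs M)) => Y.
rewrite -(sig_obj_to_rmod Y); move: (to_rmod _) => {}Y [ev [coev [d h]]].
exists Y; do 2!eexists; split; last exact: h.
by apply: transport_dual; exact: d.
Qed.

End SigmaRigid.

(** * Local modules through the reverse braiding *)

Section ReverseBraiding.
Context (C : monoidal) (c : braiding C).

Lemma inverse_uniq (X Y : C) (f : hom X Y) (g g' : hom Y X) :
  g ∘ f = idm X -> f ∘ g' = idm Y -> g = g'.
Proof. by move=> gf fg; rewrite -(id_r g) -fg -compA gf id_l. Qed.

Lemma bri_nat (X X' Y Y' : C) (f : hom X X') (g : hom Y Y') :
  bri c Y' X' ∘ (f ⊠ g) = (g ⊠ f) ∘ bri c Y X.
Proof.
apply: (iso_epi (briK c Y X)); rewrite !compA brK id_r -br_nat.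
by rewrite (rw2 _ (brK c _ _)) id_l.
Qed.

(** Both sides invert the same morphism, which [hexagon2] for [c] writes in two ways. *)
Lemma bri_hexagon1 (X Y Z : C) :
  asc Y Z X ∘ bri c (Y ⊗ Z) X ∘ asc X Y Z
  = (Y ◁ bri c Z X) ∘ asc Y X Z ∘ (bri c Y X ▷ Z).
Proof.
apply: (inverse_uniq (f := asci X Y Z ∘ br c (Y ⊗ Z) X ∘ asci Y Z X)).
  by rewrite ?compA (rw2 _ (asciK _ _ _)) id_l (rw2 _ (brK c _ _)) id_l asciK.
rewrite hexagon2 ?compA (rw2 _ (whL_iso _ (briK c _ _))) id_l.
by rewrite (rw2 _ (ascK _ _ _)) id_l (whR_iso _ (briK c _ _)).
Qed.

Lemma bri_hexagon2 (X Y Z : C) :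
  asci Z X Y ∘ bri c Z (X ⊗ Y) ∘ asci X Y Z
  = (bri c Z X ▷ Y) ∘ asci X Z Y ∘ (X ◁ bri c Z Y).
Proof.
apply: (inverse_uniq (f := asc X Y Z ∘ br c Z (X ⊗ Y) ∘ asc Z X Y)).
  by rewrite ?compA (rw2 _ (ascK _ _ _)) id_l (rw2 _ (brK c _ _)) id_l ascK.
rewrite hexagon1 ?compA (rw2 _ (whR_iso _ (briK c _ _))) id_l.
by rewrite (rw2 _ (asciK _ _ _)) id_l (whL_iso _ (briK c _ _)).
Qed.

Definition br_rev : braiding C :=
  @Braiding C (fun X Y => bri c Y X) (fun X Y => br c Y X)
    (fun X Y => briK c Y X) (fun X Y => brK c Y X)
    (fun X X' Y Y' => @bri_nat X X' Y Y') bri_hexagon1 bri_hexagon2.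

Lemma commutative_rev (A : algebra C) : commutative c A -> commutative br_rev A.
Proof. by rewrite /commutative => {1}<-; rewrite compA briK id_r. Qed.

(** The left action of [sbim] is [rra M ∘ br c A M]; cancelling the invertible [br c M A] relates
    the two conditions. *)
Lemma is_localP (A : algebra C) (hA : commutative c A) (M : rmodule A) :
  is_local c M <-> in_sigma (br_lax br_rev A) (sbim (commutative_lcc hA) M).
Proof.
rewrite /is_local /in_sigma /=; split=> e.
  by rewrite -{2}e ?compA briK id_r.
by rewrite -compA e compA brK id_r.
Qed.

End ReverseBraiding.

Theorem theorem3p8 (C : monoidal) (cl : closed C)
    (ez : equalizers C) (cq : coequalizers C) :
  (forall (A : algebra C) (s : lax_half_braiding A)
      (hs : lax_central_commutative s),
    rigid (bimod A cl cq) ->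
    rigid (sigma_mod cl cq hs) /\
    exists h : forall M : sigma_mod cl cq hs,
        in_sigma s (dagger cl ez (proj1_sig M)),
      @is_left_duality_functor (sigma_mod cl cq hs)
        (fun M => exist (in_sigma s) (dagger cl ez (proj1_sig M)) (h M))
        (fun M N f => dagger_hom cl ez f))
  /\
  (forall (c : braiding C) (A : algebra C) (hA : commutative c A),
    rigid (bimod A cl cq) ->
    (rigid (mod_A cl cq hA) /\
     (forall M : mod_A cl cq hA,
        in_sigma (br_lax c A) (dagger cl ez (sbim (commutative_lcc hA) M))) /\
     @is_left_duality_functor (mod_A cl cq hA)
       (fun M => rdagger cl ez hA M)
       (fun M N f => rdagger_hom cl ez hA f))
    /\
    (rigid (loc_mod_A cl cq hA) /\
     exists h : forall M : loc_mod_A cl cq hA,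
         is_local c (rdagger cl ez hA (proj1_sig M)),
       @is_left_duality_functor (loc_mod_A cl cq hA)
         (fun M => exist (@is_local C c A)
                     (rdagger cl ez hA (proj1_sig M)) (h M))
         (fun M N f => rdagger_hom cl ez hA f))).
Proof.
split=> [A s hs rig | c A hA rig].
  have dual : @is_left_duality_functor (sigma_mod cl cq hs)
      (sigma_dagger ez (hs := hs)) (fun M N f => dagger_hom cl ez f).
    apply: (left_duality_functorI (ev := sigma_ev ez (hs := hs)));
      [exact: sigma_ev_dual | exact: sigma_ev_dagger_hom].
  split; last by exists (fun M => dagger_in_sigma cl ez hs (proj2_sig M)); exact: dual.
  move=> M; split; first exact: left_duality_has_left_dual dual M.
  by case: (sigma_right_dual rig M) => [Y [ev [coev [d _]]]]; exists Y, ev, coev.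
pose hs := commutative_lcc hA.
split.
  have dual : @is_left_duality_functor (mod_A cl cq hA)
      (fun M => rdagger cl ez hA M) (fun M N f => rdagger_hom cl ez hA f).
    apply: (left_duality_functorI (ev := sigma_rev ez (hs := commutative_lcc hA)));
      [exact: sigma_rev_dual | exact: sigma_rev_dagger_hom].
  split; last split=> // [M].
    move=> M; split; first exact: left_duality_has_left_dual dual M.
    by case: (sigma_rmod_right_dual rig M) => [Y [ev [coev [d _]]]]; exists Y, ev, coev.
  by apply: (dagger_in_sigma cl ez hs).
have lcc_rev := commutative_lcc (commutative_rev hA).
have h (M : loc_mod_A cl cq hA) : is_local c (rdagger cl ez hA (proj1_sig M)).
  (* [rdagger] forgets the left action; membership for [c] recovers the bimodule [dagger], and
     membership for the reverse braiding is locality. *)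
  apply/(is_localP hA); rewrite (sbim_to_rmod hs).
    by apply: (dagger_in_sigma cl ez hs).
  by apply: dagger_in_sigma => //; exact/is_localP/(proj2_sig M).
pose D (M : loc_mod_A cl cq hA) : loc_mod_A cl cq hA :=
  exist (@is_local C c A) (rdagger cl ez hA (proj1_sig M)) (h M).
pose ev (M : loc_mod_A cl cq hA) : hom (D M ⊗ M) 𝟙 :=
  sigma_rev ez (hs := commutative_lcc hA) (proj1_sig M).
have dual : is_left_duality_functor (D := D) (fun M N f => rdagger_hom cl ez hA f).
  apply: (left_duality_functorI (ev := ev)) => [M | M N f].
    exact: (sigma_rev_dual ez rig (proj1_sig M)).
  exact (@sigma_rev_dagger_hom C cl ez cq A _ _ (proj1_sig M) (proj1_sig N) f).
split; last by exists h.
move=> M; split; first exact: left_duality_has_left_dual dual M.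
case: (sigma_rmod_right_dual rig (proj1_sig M)) => [Y [evY [coev [d hY]]]].
(* [hY] at the reverse braiding carries locality from [M] to its right dual. *)
have locY : is_local c Y.
  by apply/(is_localP hA)/hY => //; exact/is_localP/(proj2_sig M).
by exists (exist (@is_local C c A) Y locY), evY, coev.
Qed.
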